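(* Let $n\in\mathbb{N}$ and let $F$ be a finite simple undirected graph. Then $F$ is isomorphic to the codegree prime graph $\Delta_{\mathrm{cod}}(G)$ of a finite solvable group $G$ of $n^{th}$-power-free order if and only if the complement $\overline{F}$ satisfies the following conditions. (1) $\overline{F}$ is triangle-free. (2) There exists a $3$-coloring of $\overline{F}$ by Red, Green, and Blue and a way to label each red vertex by a distinct prime number such that, for any subset $\pi$ of those primes whose product is at least $n$, in the canonical orientation no blue vertex is simultaneously the end of directed $2$-paths starting from each of the red vertices in $\pi$ (that is, the red vertices labeled by the primes in $\pi$).
   Context: For a finite group $G$, $\mathrm{Irr}(G)$ is the set of irreducible complex characters of $G$. For $\chi\in\mathrm{Irr}(G)$ the codegree of $\chi$ is $\mathrm{cod}(\chi)=|G:\ker(\chi)|/\chi(1)$, and $\mathrm{cod}(G)=\{\mathrm{cod}(\chi) : \chi\in\mathrm{Irr}(G)\}$. The codegree prime graph $\Delta_{\mathrm{cod}}(G)$ is the simple undirected graph whose vertices are the prime divisors of the numbers in $\mathrm{cod}(G)$, two distinct vertices $p,q$ being adjacent if and only if $pq$ divides some number in $\mathrm{cod}(G)$. A positive integer is $n^{th}$-power-free if it is not divisible by $p^n$ for any prime $p$. A $3$-coloring is a proper vertex coloring. Given such a coloring by Red, Green, and Blue, the canonical orientation directs each edge between a red and a green vertex from red to green, each edge between a green and a blue vertex from green to blue, and each edge between a red and a blue vertex from red to blue. A directed $2$-path from $u$ to $w$ is a pair of directed edges $u\to v\to w$.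
   Formalization: The claim is proved for n ≥ 2 only; for n = 1 it fails for the one-vertex graph (color it red: only the trivial group has 1st-power-free order, and its graph is empty), and for n = 0 it fails for the empty graph. *)

(* Defs.v *)
From HB Require Import structures.
From mathcomp Require Import all_boot all_order all_fingroup all_algebra.
From mathcomp Require Import all_solvable all_field all_character.

Set Implicit Arguments.
Unset Strict Implicit.
Unset Printing Implicit Defensive.

Local Open Scope group_scope.
Local Open Scope ring_scope.
Local Open Scope nat_scope.

Import Order.TTheory GRing.Theory Num.Theory.

Record sgraph := SGraph {
  vertex :> finType;
  edge : rel vertex;
  edge_sym : symmetric edge;
  edge_irr : irreflexive edge
}.

Definition graph_iso (F H : sgraph) : Prop :=
  exists2 f : F -> H, bijective f & forall u v, edge (f u) (f v) = edge u v.

Section Complement.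
Variable F : sgraph.

Definition compl_edge : rel F := fun u v => (u != v) && ~~ edge u v.

Lemma compl_edge_sym : symmetric compl_edge.
Proof. by move=> u v; rewrite /compl_edge eq_sym edge_sym. Qed.

Lemma compl_edge_irr : irreflexive compl_edge.
Proof. by move=> u; rewrite /compl_edge eqxx. Qed.

Definition complement : sgraph := SGraph compl_edge_sym compl_edge_irr.
End Complement.

Definition triangle_free (F : sgraph) : Prop :=
  forall u v w : F, ~ [/\ edge u v, edge v w & edge u w].

Section Codegree.
Variables (gT : finGroupType) (G : {group gT}).

(* The quotient is taken in algC, where character values live; by codegreeE   *)
(* it is a natural number, so that Num.truncn only changes its type.          *)
Definition codegree (i : Iirr G) : nat :=
  Num.truncn (#|G : cfker 'chi_i|%:R / 'chi_i 1%g)%R.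

Lemma codegreeE (i : Iirr G) :
  ((codegree i)%:R = #|G : cfker 'chi_i|%:R / 'chi_i 1%g)%R.
Proof.
apply: truncnK.
have sKZ := normal_sub (cfker_center_normal 'chi_i).
rewrite -(Lagrange_index (cfcenter_sub 'chi_i) sKZ) natrM mulrAC.
have [d ->] := dvdCP_nat (ltW (irr1_gt0 i)) (ler0n _ _)
                 (dvd_irr1_index_center i).
by rewrite mulfK ?irr1_neq0 // -natrM natr_nat.
Qed.

Definition cod : seq nat := [seq codegree i | i : Iirr G].

Definition cod_primes : seq nat := undup (flatten [seq primes m | m <- cod]).

Lemma mem_cod_primes p :
  reflect (prime p /\ exists2 m, m \in cod & p %| m) (p \in cod_primes).
Proof.
rewrite mem_undup; apply: (iffP flatten_mapP) => [[m codm]|[p_pr [m codm p_m]]].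
  by rewrite mem_primes => /and3P[p_pr _ p_m]; split=> //; exists m.
exists m => //; rewrite mem_primes p_pr p_m andbT /=.
case/mapP: codm => i _ ->; rewrite -(ltr0n algC) codegreeE.
by rewrite divr_gt0 ?irr1_gt0 // ltr0n indexg_gt0.
Qed.

Definition cod_edge : rel (seq_sub cod_primes) := fun p q =>
  (p != q) && has (fun m => val p * val q %| m) cod.

Lemma cod_edge_sym : symmetric cod_edge.
Proof. by move=> p q; rewrite /cod_edge eq_sym mulnC. Qed.

Lemma cod_edge_irr : irreflexive cod_edge.
Proof. by move=> p; rewrite /cod_edge eqxx. Qed.

Definition cod_graph : sgraph := SGraph cod_edge_sym cod_edge_irr.
End Codegree.

Definition power_free (n m : nat) : Prop :=
  0 < m /\ forall p, prime p -> ~~ (p ^ n %| m).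

Inductive color := Red | Green | Blue.

Section Coloring.
Variables (F : sgraph) (c : F -> color).

Definition proper_coloring : Prop := forall u v, edge u v -> c u <> c v.

Definition arc (u v : F) : bool :=
  edge u v &&
  match c u, c v with
  | Red, Green | Green, Blue | Red, Blue => true
  | _, _ => false
  end.

Definition two_path (u w : F) : Prop := exists v, arc u v /\ arc v w.

(* Values of l outside the red vertices are irrelevant. *)
Definition red_labeling (l : F -> nat) : Prop :=
  (forall u, c u = Red -> prime (l u)) /\
  (forall u v, c u = Red -> c v = Red -> l u = l v -> u = v).

(* A finite set of primes is a duplicate-free sequence pi. *)
Definition bounded_two_paths (n : nat) (l : F -> nat) : Prop :=
  forall pi : seq nat, uniq pi ->
    (forall p, p \in pi -> exists2 u, c u = Red & l u = p) ->
    n <= \prod_(p <- pi) p ->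
  ~ exists2 w, c w = Blue &
      forall u, c u = Red -> l u \in pi -> two_path u w.
End Coloring.

(* Main.v *)
Require Import Defs.
From HB Require Import structures.
From mathcomp Require Import all_boot all_order all_fingroup all_algebra.
From mathcomp Require Import all_solvable all_field all_character.

(** Call p and q GK-adjacent in G when G has an element of order pq. In a solvable
    group, GK-adjacent primes are adjacent in the codegree graph
    ([exists_codegree_order_mul]), so the edges of the complement of the codegree
    graph are pairs of primes that are not GK-adjacent.

    From a group to a coloring. For primes p, q that are not GK-adjacent, say that p
    is above q when some quotient of G has order divisible by p and prime to q. This
    orients every such pair ([above_total], [above_asym]). If p is above q, then by
    the Frattini argument an element x of order p normalizes a Sylow q-subgroup Q,
    and acts freely on it. If moreover q is above s, then Q acts freely on every
    s-chief factor V of G, and V is a module of a Frobenius group Q <[x]>: Clifford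
    theory shows that p divides the dimension of V, and a computation in the group ring
    shows that x has a fixed point in V ([frob_abelem_dim], [frob_abelem_fixed]).
    So a directed path p, q, s has two consequences ([above_path_dim]): p divides the
    exponent of s in #|G|, and p, s are GK-adjacent. As an oriented triangle contains
    a directed path with two arrows, there are no triangles. There are no directed
    paths p, q, r, s with three arrows either ([no_three_path]): a Sylow r-subgroup R
    would act freely on an s-group, hence be cyclic or nearly so, whereas p divides the
    dimension of R / Phi(R). Coloring the sources Red, the other sinks Blue and
    everything else Green is therefore proper, and if a blue vertex is reached by 2-paths
    from red vertices, then the product of their primes divides the exponent of the
    blue prime in #|G|, which is less than n ([cod_graph_coloring]).

    From a coloring to a group. The group is a semidirect product of blue modules
    with a metabelian group. Let R be cyclic with order m the product of the red
    labels; give each green vertex v a prime g v congruent to 1 modulo m, and let R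
    act on the group of order g v so that exactly the red groups adjacent to v act
    nontrivially. Give each blue vertex w a prime b w congruent to 1 modulo m and all
    g v. Its module over 'F_(b w) has dimension d, the product of the labels of the
    red vertices with a 2-path to w, and d is less than n by hypothesis
    ([blue_dim_lt]). The module is monomial: R shifts the d coordinates cyclically,
    the red groups adjacent to w act by scalars, and the green groups adjacent to w
    act diagonally. A red vertex is never both adjacent to w and the start of a 2-path
    to w, as there are no triangles. Vertices that are not adjacent have commuting
    generators, which gives an element of order the product of the two primes
    ([vertex_gen_commute], [codegree_of_nonedge]). For adjacent vertices GK-adjacency
    would not be enough to conclude, and the codegrees are handled directly
    ([codegree_edge]): one generator acts freely on a normal subgroup, of G or of
    G / ker, so the inertia groups of the nontrivial characters of that subgroup
    avoid its prime, which is then absorbed by the degree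
    ([not_dvd_codegree_regular]). *)

Set Implicit Arguments.
Unset Strict Implicit.
Unset Printing Implicit Defensive.

Import Order.TTheory GRing.Theory Num.Theory.

Local Open Scope group_scope.
Local Open Scope ring_scope.
Local Open Scope nat_scope.

(** * Codegrees, normal subgroups and element orders *)

(** The degree as a natural number, so that divisibility can be stated in nat. *)
Definition deg (gT : finGroupType) (G : {group gT}) (i : Iirr G) : nat :=
  irr_degree (socle_of_Iirr i).

Section Deg.
Variables (gT : finGroupType) (G : {group gT}).
Implicit Types (i : Iirr G).

Lemma degE i : 'chi_i 1%g = (deg i)%:R%R.
Proof. exact: irr1_degree. Qed.

Lemma deg_gt0 i : 0 < deg i.
Proof. exact: irr_degree_gt0. Qed.

Lemma codegreeM i : (codegree i * deg i)%N = #|G : cfker 'chi_i|.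
Proof.
apply/eqP; rewrite -(eqr_nat algC) natrM codegreeE -degE divfK //.
exact: irr1_neq0.
Qed.

Lemma codegree_dvd_card i : codegree i %| #|G|.
Proof.
apply: dvdn_trans (dvdn_indexg G (cfker 'chi_i)).
by rewrite -codegreeM dvdn_mulr.
Qed.

End Deg.

(** Ito's theorem. The Clifford correspondent of 'chi_i in the inertia group T
    of a constituent on M has M in its center, so its degree divides #|T : M|,
    and induction to G multiplies degree and group order by the same #|G : T|. *)
Lemma abelian_normal_dvd_deg (gT : finGroupType) (G M : {group gT}) (i : Iirr G) :
  M <| G -> abelian M -> deg i * #|M| %| #|G|.
Proof.
move=> nsMG cMM; have [sMG nMG] := andP nsMG.
have [t tM] := constt_cfRes_irr M i.
have [indG _ imG _ _] := constt_Inertia_bijection t nsMG.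
have: i \in irr_constt ('Ind[G] 'chi_t) by rewrite constt_Ind_Res.
rewrite -imG => /imsetP[s As Di].
have Dchi : 'chi_i = 'Ind[G] 'chi_s by rewrite Di cfIirrE ?indG.
set T := 'I_G['chi_t]%G in s As Di Dchi.
have sTG : T \subset G by apply: subsetIl.
have nsMT : M <| T by apply: normal_Inertia.
have sMZ : M \subset 'Z('chi_s)%CF.
  apply/subsetP=> x Mx; have Tx := subsetP (normal_sub nsMT) x Mx.
  rewrite irr_cfcenterE //.
  have tMs : t \in irr_constt ('Res[M] 'chi_s) by rewrite -constt_Ind_Res.
  have := Clifford_Res_sum_cfclass nsMT tMs.
  rewrite cfclass_invariant ?subsetIr // big_seq1 => DR.
  have lint := char_abelianP _ cMM t.
  rewrite -(cfResE _ (normal_sub nsMT) Mx) -(cfRes1 M) DR !cfunE.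
  rewrite normrM (normC_lin_char lint) // lin_char1 // !mulr1.
  by rewrite ger0_norm // natr_ge0 // Cnat_cfdot_char ?cfRes_char ?irr_char.
have := dvd_irr1_index_center s.
rewrite degE dvdC_nat => dsZ.
have -> : deg i = (#|G : T| * deg s)%N.
  by apply/eqP; rewrite -(eqr_nat algC) natrM -!degE Dchi cfInd1.
rewrite -(Lagrange sTG) mulnAC -mulnA [(#|T| * _)%N]mulnC dvdn_pmul2l //.
rewrite -(Lagrange (cfcenter_sub 'chi_s)).
by apply: dvdn_mul => //; apply: cardSg.
Qed.

Lemma codegree_mod (gT : finGroupType) (G K : {group gT}) (i : Iirr (G / K)%g) :
  K <| G -> codegree (mod_Iirr i) = codegree i.
Proof.
move=> nsKG; have [sKG nKG] := andP nsKG.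
have Ddeg : deg (mod_Iirr i) = deg i.
  apply/eqP; rewrite -(eqr_nat algC) -!degE mod_IirrE //.
  by rewrite cfModE // ?morph1.
apply/eqP; rewrite -(eqn_pmul2r (deg_gt0 i)) codegreeM -{1}Ddeg codegreeM.
apply/eqP; rewrite mod_IirrE //.
have sK := cfker_mod 'chi_i nsKG.
rewrite -(index_quotient_eq _ (cfker_sub _) nKG); last first.
  by rewrite subIset // sK orbT.
by rewrite (quotient_cfker_mod G).
Qed.

(** A codegree only sees G / ker, which is why Ito's theorem, a statement on
    #|G| / deg, applies to codegrees once the kernel has been factored out. *)
Lemma codegree_quo_faithful (gT : finGroupType) (G : {group gT}) (i : Iirr G) :
  exists2 j : Iirr (G / cfker 'chi_i)%g, codegree i = codegree j &
    cfaithful 'chi_j.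
Proof.
have nsKG := cfker_normal 'chi_i.
exists (quo_Iirr (cfker 'chi_i) i).
  by rewrite -(codegree_mod _ nsKG) quo_IirrK.
rewrite quo_IirrE // /cfaithful cfker_quo //=.
by rewrite trivg_quotient.
Qed.

Lemma dvd_codegree_of_normal (gT : finGroupType) (G M : {group gT}) q
    (i : Iirr G) :
  prime q -> M <| G -> abelian M -> q.-group M -> ~~ (M \subset cfker 'chi_i) ->
  q %| codegree i.
Proof.
move=> q_pr nsMG cMM qM nKM; have [j -> ffj] := codegree_quo_faithful i.
set K := cfker 'chi_i in nKM j ffj *.
have nsMK : (M / K <| G / K)%g by apply: quotient_normal.
have nKG : G \subset 'N(K) := cfker_norm _.
have nKM' : M \subset 'N(K) := subset_trans (normal_sub nsMG) nKG.
have nt : (M / K != 1)%g by rewrite -subG1 quotient_sub1.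
have [_ qMK _] := pgroup_pdiv (quotient_pgroup K qM) nt.
have := abelian_normal_dvd_deg j nsMK (quotient_abelian K cMM).
have -> : #|(G / K)%g| = (deg j * codegree j)%N.
  rewrite mulnC codegreeM.
  by move: ffj; rewrite /cfaithful subG1 => /eqP ->; rewrite indexg1.
by rewrite dvdn_pmul2l ?deg_gt0 //; apply: dvdn_trans.
Qed.

(** Clifford: the restriction to M is a multiple of the sum of the #|G : T|
    conjugates of the linear character 'chi_t. *)
Lemma deg_constt_Ind_lin (gT : finGroupType) (G M : {group gT}) (t : Iirr M) (i : Iirr G) :
  M <| G -> 'chi_t \is a linear_char -> i \in irr_constt ('Ind[G] 'chi_t) ->
  deg i = (Num.truncn '['Ind[G] 'chi_t, 'chi_i] * #|G : 'I_G['chi_t]|)%N.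
Proof.
move=> nsMG lint; rewrite constt_Ind_Res => ti.
apply/eqP; rewrite -(eqr_nat algC) natrM -degE -(cfRes1 M).
rewrite (Clifford_Res_sum_cfclass nsMG ti) cfunE sum_cfunE.
rewrite truncnK; last by rewrite Cnat_cfdot_char ?cfInd_char ?irr_char.
rewrite cfdot_Res_l cfdotC conj_natr ?Cnat_cfdot_char ?cfInd_char ?irr_char //.
apply/eqP; congr (_ * _)%R.
rewrite -size_cfclass -sum1_size natr_sum; apply: eq_big_seq => _ /cfclassP[y Gy ->].
by rewrite cfConjg1 lin_char1.
Qed.

(** If every constituent i of the induced character had a degree divisible by
    the p-part of #|G|, then so would the multiplicities times #|G : T|, and
    summing the squares, #|G : M| * #|G : T| would be divisible by the square
    of that p-part; but p divides #|T|, so #|G : T| has a smaller p-part. *)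
Lemma exists_constt_pdiv (gT : finGroupType) (G M : {group gT}) (t : Iirr M) p :
  prime p -> M <| G -> 'chi_t \is a linear_char -> p %| #|'I_G['chi_t]| ->
  exists2 i : Iirr G, i \in irr_constt ('Ind[G] 'chi_t) & deg i * p %| #|G|.
Proof.
move=> p_pr nsMG lint pT; have sMG := normal_sub nsMG.
set T := 'I_G['chi_t] in pT.
pose a (i : Iirr G) := Num.truncn '['Ind[G] 'chi_t, 'chi_i].
have Da (i : Iirr G) : '['Ind[G] 'chi_t, 'chi_i] = (a i)%:R%R.
  by rewrite truncnK // Cnat_cfdot_char ?cfInd_char ?irr_char.
have dega (i : Iirr G) :
    i \in irr_constt ('Ind[G] 'chi_t) -> deg i = (a i * #|G : T|)%N.
  exact: deg_constt_Ind_lin.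
have [/exists_inP // | ] := boolP [exists i in irr_constt ('Ind[G] 'chi_t),
                                     deg i * p %| #|G|].
rewrite negb_exists_in => /forall_inP noi; exfalso.
have pG : 0 < #|G| by [].
pose e := logn p #|G|.
have dvi i : i \in irr_constt ('Ind[G] 'chi_t) -> p ^ e %| deg i.
  move=> ti; have := noi i ti; have [c Dc] : exists c, #|G| = (deg i * c)%N.
    exists (#|cfker 'chi_i| * codegree i)%N.
    by rewrite mulnC -mulnA codegreeM Lagrange ?cfker_sub.
  rewrite Dc dvdn_pmul2l ?deg_gt0 // => npc.
  have := pfactor_dvdnn p #|G|; rewrite -/e {1}Dc Gauss_dvdl //.
  by apply: coprimeXl; rewrite prime_coprime.
have DI : #|G : M| = (\sum_(i in irr_constt ('Ind[G] 'chi_t))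
    a i * deg i)%N.
  apply/eqP; rewrite -(eqr_nat algC).
  have <- : ('Ind[G] 'chi_t) 1%g = #|G : M|%:R%R by rewrite cfInd1 // lin_char1 // mulr1.
  rewrite {1}['Ind[G] _]cfun_sum_constt sum_cfunE natr_sum.
  apply/eqP/eq_bigr=> i ti.
  by rewrite cfunE natrM degE Da.
have : p ^ (e + e) %| #|G : M| * #|G : T|.
  rewrite DI big_distrl /=; apply: dvdn_sum => i ti.
  by rewrite mulnAC -dega // expnD dvdn_mul ?dvi.
rewrite pfactor_dvdn ?muln_gt0 ?indexg_gt0 // lognM ?indexg_gt0 //.
apply/negP; rewrite -ltnNge -addnS leq_add //.
  by rewrite dvdn_leq_log // dvdn_indexg.
rewrite /e -(Lagrange (Inertia_sub G 'chi_t)) lognM ?cardG_gt0 ?indexg_gt0 //.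
by rewrite -/T addnC -addn1 leq_add2l logn_gt0 mem_primes p_pr cardG_gt0.
Qed.

Lemma sub_cfker_constt (gT : finGroupType) (G M A : {group gT}) (i : Iirr G) (t : Iirr M) :
  M \subset G -> A \subset M -> i \in irr_constt ('Ind[G] 'chi_t) ->
  A \subset cfker 'chi_i -> A \subset cfker 'chi_t.
Proof.
move=> sMG sAM; rewrite constt_Ind_Res => ti sAK.
apply: subset_trans (cfker_constt _ ti); last by rewrite cfRes_char ?irr_char.
by rewrite cfker_Res ?irr_char // subsetI sAM.
Qed.

Lemma irr_neq0_ker (gT : finGroupType) (M : {group gT}) (t : Iirr M) :
  t != 0%R -> ~~ (M \subset cfker 'chi_t).
Proof. by rewrite subGcfker. Qed.

(** Every prime divisor of the order is a vertex of the codegree graph: pass to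
    quotients until p divides the order of a minimal normal subgroup M, and take
    a character that is not trivial on M. *)
Lemma exists_codegree_pdiv (gT : finGroupType) (G : {group gT}) p :
  solvable G -> prime p -> p %| #|G| -> exists i : Iirr G, p %| codegree i.
Proof.
move=> solG p_pr; have [n] := ubnP #|G|; elim: n gT G solG => // n IHn gT G solG.
rewrite ltnS => leGn pG.
have ntG : G :!=: 1%g.
  by apply: contraTneq pG => ->; rewrite cards1 dvdn1 gtn_eqF ?prime_gt1.
have [M minM sMG] := minnormal_exists ntG (normG G).
have [nMG ntM /is_abelemP[q q_pr abM]] := minnormal_solvable minM sMG solG.
have nsMG : M <| G by rewrite /normal sMG.
have [pGM | npGM] := boolP (p %| #|(G / M)%g|).
  have [] // := IHn _ (G / M)%G (quotient_sol _ solG).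
    by apply: leq_trans leGn; rewrite ltn_quotient.
  by move=> j pj; exists (mod_Iirr j); rewrite codegree_mod.
have pM : p %| #|M|.
  move: pG; rewrite -(Lagrange sMG) Euclid_dvdM // -card_quotient //.
  by rewrite (negPf npGM) orbF.
have [qM cMM _] := and3P abM.
have Dq : p = q.
  by apply/eqP; have /pgroupP/(_ p p_pr pM) := qM.
have [t nt_t] := has_nonprincipal_irr ntM.
have [i ti] := constt_cfInd_irr t sMG.
exists i; apply: (dvd_codegree_of_normal p_pr nsMG cMM); first by rewrite Dq.
apply: contra (irr_neq0_ker nt_t) => sMK.
exact: sub_cfker_constt sMG (subxx _) ti sMK.
Qed.

(** The fixed points of x on M keep [M, x] proper in M, and a character of
    M / [M, x] is x-invariant. *)
Lemma exists_invariant_irr (gT : finGroupType) (M : {group gT}) x :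
  abelian M -> x \in 'N(M) -> coprime #|M| #[x] -> 'C_M[x] != 1%g ->
  exists2 t : Iirr M, t != 0%R & x \in 'I['chi_t].
Proof.
move=> cMM nMx coMx ntC.
have nMX : <[x]> \subset 'N(M) by rewrite cycle_subG.
have tiD := coprime_abel_cent_TI nMX coMx cMM.
set D := [~: M, <[x]>]%G in tiD *.
have nsDM : D <| M.
  by rewrite -sub_abelian_normal //= commg_subl.
have ntMD : (M / D != 1)%g.
  rewrite -subG1 quotient_sub1 ?normal_norm //; apply: contra ntC => sMD.
  by rewrite -subG1 /= -cent_cycle (subset_trans (setSI _ sMD)) // tiD.
have [j nt_j] := has_nonprincipal_irr ntMD.
exists (mod_Iirr j); first by rewrite -(mod_Iirr0 M D) (inj_eq (can_inj (mod_IirrK nsDM))).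
have lint : 'chi_(mod_Iirr j) \is a linear_char := char_abelianP _ cMM _.
have sDK : D \subset cfker 'chi_(mod_Iirr j) by rewrite mod_IirrE // cfker_mod.
rewrite inE nMx /=; apply/eqP/cfun_inP=> m Mm.
have Mm' : (m ^ x^-1)%g \in M by rewrite memJ_norm ?groupV.
rewrite cfConjgE // -[m in RHS](conjgKV x) [(_ ^ x)%g in RHS]conjg_mulR.
by rewrite [RHS]cfkerMr // (subsetP sDK) // mem_commg ?cycle_id.
Qed.

Lemma order_quotient_TI (gT : finGroupType) (K : {group gT}) x :
  x \in 'N(K) -> K :&: <[x]> = 1%g -> #[coset K x] = #[x].
Proof.
move=> nKx tiKx; rewrite !orderE -quotient_cycle //.
by rewrite -(card_isog (quotient_isog _ tiKx)) // cycle_subG.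
Qed.

(** An element x of order pq puts pq into some codegree. By induction every
    minimal normal subgroup meets <[x]>. If there are both a minimal normal
    q-subgroup M and a minimal normal p-subgroup N, a character of M x N that is
    nontrivial on both factors works. If M is the only minimal normal subgroup,
    every character over a nontrivial one of M is faithful and has q in its
    codegree; the p-part of x fixes an element of M, hence a nontrivial character
    of M, and exists_constt_pdiv yields a character over it that keeps p. *)
Lemma exists_codegree_order_mul (gT : finGroupType) (G : {group gT}) x p q :
  solvable G -> x \in G -> prime p -> prime q -> p != q -> #[x] = (p * q)%N ->
  exists i : Iirr G, p * q %| codegree i.
Proof.
have [n] := ubnP #|G|; elim: n gT G x p q => // n IHn gT G x p q.
rewrite ltnS => leGn solG Gx p_pr q_pr neq_pq ox.
have co_pq : coprime p q by rewrite prime_coprime // dvdn_prime2.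
have p1 := prime_gt1 p_pr; have q1 := prime_gt1 q_pr.
have p0 := prime_gt0 p_pr; have q0 := prime_gt0 q_pr.
have ntG : G :!=: 1%g.
  apply: contraTneq Gx => ->; rewrite inE -order_eq1 ox.
  by rewrite neq_ltn; apply/orP; right; rewrite (leq_trans p1) // leq_pmulr.
(* a minimal normal subgroup meeting <[x]> trivially allows induction *)
have min_meet (M : {group gT}) : minnormal M G -> M \subset G ->
  (exists i : Iirr G, p * q %| codegree i) \/
  exists r, [/\ prime r, r.-abelem M, r \in [:: p; q] & (x ^+ (p * q %/ r))%g \in M].
  move=> minM sMG.
  have [nMG ntM /is_abelemP[r r_pr abM]] := minnormal_solvable minM sMG solG.
  have nsMG : M <| G by rewrite /normal sMG.
  have [tiM | ntMx] := eqVneq (M :&: <[x]>)%g 1%g.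
    left; have [] // := IHn _ (G / M)%G (coset M x) p q.
    - by apply: leq_trans leGn; rewrite ltn_quotient.
    - exact: quotient_sol.
    - exact: mem_quotient.
    - by rewrite order_quotient_TI // (subsetP nMG).
    by move=> j pj; exists (mod_Iirr j); rewrite codegree_mod.
  right; exists r.
  have rMx : r.-group (M :&: <[x]>)%G := pgroupS (subsetIl _ _) (abelem_pgroup abM).
  have [_ r_dvd _] := pgroup_pdiv rMx ntMx.
  have r_pq : r %| p * q by rewrite -ox orderE (dvdn_trans r_dvd) // cardSg ?subsetIr.
  split=> //.
    by move: r_pq; rewrite Euclid_dvdM // !dvdn_prime2 // !inE.
  have [y My oy] := Cauchy r_pr r_dvd; have [My1 xy] := setIP My.
  suff: <[x ^+ (p * q %/ r)]> = <[y]> by move=> E; rewrite -cycle_subG E cycle_subG.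
  apply/eqP; rewrite (eq_subG_cyclic (cycle_cyclic x)) ?cycle_subG ?mem_cycle //.
  rewrite -!orderE oy orderXdiv ox ?dvdn_div //.
  by rewrite divnA // mulKn // muln_gt0 p0.
have [M minM sMG] := minnormal_exists ntG (normG G).
have [//| [r [r_pr abM r_pq xrM]]] := min_meet M minM sMG.
wlog Dr : p q p_pr q_pr neq_pq ox co_pq p1 q1 p0 q0 min_meet r_pq xrM / r = q.
  move=> IH; have := r_pq; rewrite !inE => /orP[/eqP Dr | /eqP Dr]; last exact: (IH p q).
  have Epq := mulnC p q; rewrite Epq in ox min_meet xrM *.
  apply: (IH q p) => //; rewrite 1?eq_sym 1?coprime_sym //.
    move=> M0 minM0 sM0G; have [|[r0 [? ? r0E ?]]] := min_meet M0 minM0 sM0G; first by left.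
    by right; exists r0; split=> //; move: r0E; rewrite !inE orbC.
  by move: r_pq; rewrite !inE orbC.
rewrite {r}Dr in r_pr abM r_pq xrM.
have {r_pq}xqM : (x ^+ p)%g \in M by rewrite mulnK in xrM.
have [qM cMM _] := and3P abM.
have [nMG ntM _] := minnormal_solvable minM sMG solG.
have nsMG : M <| G by rewrite /normal sMG.
have [xp_p oxp oxq] : [/\ #[x ^+ q] = p, #[x ^+ p] = q & commute (x ^+ q) (x ^+ p)]%g.
  split; last exact/commuteX2.
    by rewrite orderXdiv; rewrite ox ?mulnK ?dvdn_mull.
  by rewrite orderXdiv; rewrite ox ?mulKn ?dvdn_mulr.
have ntxp : (x ^+ p != 1)%g by rewrite -order_eq1 oxp gtn_eqF.
have [/existsP[N] | noN] := boolP [exists N : {group gT},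
    [&& minnormal N G, N \subset G & p.-abelem N]].
  case/and3P=> minN sNG abN; have [pN cNN _] := and3P abN.
  have [nNG ntN _] := minnormal_solvable minN sNG solG.
  have nsNG : N <| G by rewrite /normal sNG.
  have coMN : coprime #|M| #|N|.
    by rewrite (pnat_coprime qM) // (sub_in_pnat _ pN) // => ? _ /eqP->; rewrite !inE.
  have tiMN := coprime_TIg coMN.
  have cMN : N \subset 'C(M).
    rewrite (sameP commG1P trivgP) /= -tiMN subsetI commg_subl commg_subr.
    by rewrite (subset_trans sNG nMG) (subset_trans sMG nNG).
  have dpMN := dprodEY cMN tiMN.
  have [t nt_t] := has_nonprincipal_irr ntM.
  have [s nt_s] := has_nonprincipal_irr ntN.
  have sMNG : M <*> N \subset G by rewrite join_subG sMG.
  have [i ts_i] := constt_cfInd_irr (dprod_Iirr dpMN (t, s)) sMNG.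
  exists i; rewrite Gauss_dvd //; apply/andP; split.
    apply: (dvd_codegree_of_normal p_pr nsNG cNN) => //.
    apply: contra (irr_neq0_ker nt_s) => sNK.
    have := sub_cfker_constt sMNG (joing_subr M N) ts_i sNK.
    rewrite dprod_IirrE -[X in _ -> _ \subset cfker X](cfDprodKr_abelian dpMN t cMM).
    by move=> sK; rewrite cfker_Res ?cfDprod_char ?irr_char ?joing_subr // subsetI subxx.
  apply: (dvd_codegree_of_normal q_pr nsMG cMM) => //.
  apply: contra (irr_neq0_ker nt_t) => sMK.
  have := sub_cfker_constt sMNG (joing_subl M N) ts_i sMK.
  rewrite dprod_IirrE -[X in _ -> _ \subset cfker X](cfDprodKl_abelian dpMN s cNN).
  by move=> sK; rewrite cfker_Res ?cfDprod_char ?irr_char ?joing_subl // subsetI subxx.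
move: noN; rewrite negb_exists => /forallP noN.
have [//| uniM] : (exists i : Iirr G, p * q %| codegree i) \/
   forall K : {group gT}, K <| G -> K :!=: 1%g -> M \subset K.
  have [/existsP[K /and3P[nsKG ntK nMK]] | ] := boolP [exists K : {group gT},
     [&& K <| G, K :!=: 1%g & ~~ (M \subset K)]]; last first.
    rewrite negb_exists => /forallP noK; right=> K nsKG ntK.
    by have := noK K; rewrite nsKG ntK /= negbK.
  left; have [N minN sNK] := minnormal_exists ntK (normal_norm nsKG).
  have sNG := subset_trans sNK (normal_sub nsKG).
  have [//| [r' [_ abN r_pq xrN]]] := min_meet N minN sNG.
  case/negP: nMK; apply: subset_trans sNK.
  have := noN N; rewrite minN sNG /= => npN.
  have Dr : r' = q.
    by move: r_pq; rewrite !inE => /orP[/eqP Dr|/eqP//]; rewrite Dr (negPf npN) in abN.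
  rewrite Dr mulnK // in xrN.
  have [nNG _ _] := minnormal_solvable minN sNG solG.
  have [_ minP] := mingroupP minM.
  rewrite -(minP (M :&: N)%G) ?subsetIl ?subsetIr // normsI // andbT.
  by apply: contra ntxp => /eqP/setP/(_ (x ^+ p)%g); rewrite !inE xqM xrN.
have co : coprime #|M| #[x ^+ q]%g.
  by rewrite xp_p coprime_sym prime_coprime //
    (contraNN _ (negbT (negPf neq_pq))) // => pM; have /pgroupP/(_ p p_pr pM) := qM.
have [t nt_t It] : exists2 t : Iirr M, t != 0%R & (x ^+ q)%g \in 'I['chi_t].
  apply: exists_invariant_irr co _ => //; first by rewrite (subsetP nMG) ?groupX.
  have: (x ^+ p \in 'C_M[x ^+ q])%g by apply/setIP; split=> //; apply/cent1P.
  by apply: contraTneq => ->; rewrite inE.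
have lint : 'chi_t \is a linear_char := char_abelianP _ cMM t.
have [i ti dvi] : exists2 i : Iirr G, i \in irr_constt ('Ind[G] 'chi_t) & deg i * p %| #|G|.
  apply: exists_constt_pdiv => //; rewrite -xp_p.
  by apply: order_dvdG; rewrite inE groupX.
have nMK : ~~ (M \subset cfker 'chi_i).
  by apply: contra (irr_neq0_ker nt_t) => /(sub_cfker_constt sMG (subxx _) ti).
exists i; rewrite Gauss_dvd // (dvd_codegree_of_normal q_pr nsMG) // andbT.
have K1 : cfker 'chi_i = 1%g.
  apply/eqP; apply: contraR nMK => ntK.
  exact: (uniM (cfker_group 'chi_i) (cfker_normal _) ntK).
by move: dvi; rewrite -[#|G|](indexg1 G) -K1 -codegreeM mulnC dvdn_pmul2r ?deg_gt0.
Qed.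

(** * Fixed-point-free actions force primes out of codegrees *)

(** The map v |-> [~ v, x] is injective when x has no fixed point. *)
Lemma regular_commg_surj (gT : finGroupType) (U : {group gT}) x :
  x \in 'N(U) -> 'C_U[x] = 1%g -> [set [~ v, x] | v in U] = U.
Proof.
move=> nUx regx; apply/eqP; rewrite eqEcard; apply/andP; split.
  apply/subsetP=> _ /imsetP[v Uv ->].
  by rewrite commgEl groupMl ?groupV // memJ_norm.
rewrite card_in_imset // => v w Uv Uw; rewrite !commgEl => Evw.
have: (w * v^-1 \in 'C_U[x])%g.
  apply/setIP; split; first by rewrite groupM ?groupV.
  apply/cent1P; apply/commgP/conjg_fixP.
  have Ew : (w ^ x = w * v^-1 * v ^ x)%g by rewrite -mulgA Evw mulKVg.
  by rewrite conjMg conjVg Ew mulgK.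
by rewrite regx => /set1P/(canRL (mulgKV _)); rewrite mul1g.
Qed.


Lemma Sylow_not_sub_cfker (gT : finGroupType) (G S : {group gT}) p (i : Iirr G) :
  prime p -> p.-Sylow(G) S -> p %| codegree i -> ~~ (S \subset cfker 'chi_i).
Proof.
move=> p_pr /and3P[sSG _ p'S] pi; apply/negP=> sSK.
move: p'S; rewrite p'natE // => /negP; apply.
apply: dvdn_trans pi (dvdn_trans _ (indexgS G sSK)).
by rewrite -codegreeM dvdn_mulr.
Qed.

(** A constituent t of the restriction to N is nontrivial. Its inertia group
    contains no element of order p: such an element would generate a conjugate of
    the Sylow subgroup <[e]>, and an e-invariant character of N is trivial on all
    commutators [~ v, e], that is, on N. So p divides the number of conjugates of
    t, hence the degree, and the codegree cannot contain p a second time. *)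
Lemma not_dvd_codegree_regular (gT : finGroupType) (G N : {group gT}) e p (i : Iirr G) :
  prime p -> N <| G -> abelian N -> e \in G -> #[e] = p -> ~~ (p ^ 2 %| #|G|) ->
  'C_N[e] = 1%g -> ~~ (N \subset cfker 'chi_i) -> ~~ (p %| codegree i).
Proof.
move=> p_pr nsNG cNN Ge oe p2G rege nNK; have [sNG nNG] := andP nsNG.
have sylP x : x \in G -> #[x] = p -> p.-Sylow(G) <[x]>.
  move=> Gx ox; rewrite /pHall cycle_subG Gx /pgroup -orderE ox pnat_id //=.
  rewrite p'natE //; apply: contra p2G => pi.
  by rewrite -(Lagrange (_ : <[x]> \subset G)) ?cycle_subG // -orderE ox dvdn_mul.
have [t ti] := constt_cfRes_irr N i.
have lin (s : Iirr N) : 'chi_s \is a linear_char := char_abelianP _ cNN s.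
have pT : p %| #|G : 'I_G['chi_t]|.
  apply: contraR nNK => npT.
  have pT : p %| #|'I_G['chi_t]|.
    have : p %| #|G| by rewrite -oe order_dvdG.
    by rewrite -(Lagrange (Inertia_sub G 'chi_t)) Euclid_dvdM // (negPf npT) orbF.
  have [x Tx ox] := Cauchy p_pr pT; have Gx := subsetP (Inertia_sub _ _) x Tx.
  have [y Gy Exy] := Sylow_trans (sylP e Ge oe) (sylP x Gx ox).
  have Tey : (e ^ y \in 'I['chi_t])%g.
    have : (e ^ y)%g \in <[x]> by rewrite Exy memJ_conjg cycle_id.
    by apply: subsetP; rewrite cycle_subG; case/setIP: Tx.
  pose t' := conjg_Iirr t y^-1.
  have Ie : e \in 'I['chi_t'].
    rewrite conjg_IirrE -conjg_inertia ?groupV ?(subsetP nNG) //.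
    by rewrite mem_conjg invgK.
  suff : t' == 0%R.
    rewrite conjg_Iirr_eq0 => /eqP t0; apply: constt0_Res_cfker => //.
    by rewrite -t0.
  rewrite -subGcfker; apply/subsetP=> m Nm.
  have nNe := subsetP nNG e Ge.
  move: (Nm); rewrite -{1}(regular_commg_surj nNe rege) => /imsetP[v Nv ->].
  have Nve : (v ^ e)%g \in N by rewrite memJ_norm.
  rewrite cfkerEirr inE commgEl lin_charM ?groupV //.
  by rewrite (inertia_valJ _ Ie) -lin_charM ?groupV // mulVg.
have pdeg : p %| deg i.
  by rewrite (deg_constt_Ind_lin nsNG (lin t)) ?constt_Ind_Res // dvdn_mull.
apply: contra p2G => pcod.
apply: dvdn_trans (dvdn_indexg G (cfker 'chi_i)).
by rewrite -codegreeM -mulnn dvdn_mul.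
Qed.

(** * Modules over Frobenius groups *)

Section FrobeniusModule.
Variables (gT : finGroupType) (U : {group gT}) (x : gT) (p : nat).
Hypotheses (nUx : x \in 'N(U)) (p_pr : prime p) (ox : #[x] = p).
Hypotheses (coUp : coprime #|U| p) (regx : 'C_U[x] = 1%g).
Let H := (U <*> <[x]>)%G.

Let nUX : <[x]> \subset 'N(U). Proof. by rewrite cycle_subG. Qed.
Let sUH : U \subset H. Proof. exact: joing_subl. Qed.
Let Hx : x \in H. Proof. by rewrite mem_gen // inE cycle_id orbT. Qed.
Let nsUH : U <| H.
Proof. by rewrite /normal sUH join_subG normG. Qed.

Lemma card_frob_join : #|H| = (#|U| * p)%N.
Proof.
by rewrite /= norm_joinEr // TI_cardMg ?coprime_TIg // -orderE ox.
Qed.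

Lemma index_frob_join : #|H : U| = p.
Proof. by rewrite -divgS // card_frob_join mulKn. Qed.

(** In an irreducible module of U <[x]>, the homogeneous components of U are
    permuted transitively by a group of prime order p, so there are p of them, and
    the dimension is divisible by p, or there is only one. In the latter case all
    U-lines carry the same weight; it is then x-invariant, hence trivial on the
    commutators [~ u, x], that is, on U. *)
Lemma frob_irr_dim (F : fieldType) n (rG : mx_representation F H n) :
  abelian U -> group_splitting_field F U ->
  (forall v : 'rV_n, (forall u, u \in U -> v *m rG u = v) -> v = 0)%R ->
  mx_irreducible rG -> p %| n.
Proof.
move=> cUU splitU fix0 irrG; pose rU := subg_repr rG (normal_sub nsUH).
apply: (socle_exists rU) => sU.
have trH := Clifford_atrans irrG sU.
have sHD : H \subset H by [].
have dvp : #|[set: sU]| %| p.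
  apply: dvdn_trans (atrans_dvd_index_in sHD trH) _.
  rewrite -index_frob_join indexgS // subsetI sUH.
  by apply: subset_trans (Clifford_astab sU); apply: joing_subl.
case/imsetP: (trH) => W _ _.
have rkW := Clifford_rank_components irrG W.
rewrite cardsT in dvp.
have /primeP[_ /(_ _ dvp)/orP[/eqP card1 | /eqP cardp]] := p_pr; last first.
  by rewrite -rkW cardp dvdn_mulr.
have simM := socle_simple W; set M := socle_base W in simM.
have rM1 := mxsimple_abelian_linear splitU cUU simM.
have simMx : mxsimple rU (M *m rG x)%R := Clifford_simple simM Hx.
have [f injf homf Mfx] : mx_iso rU M (M *m rG x)%R.
  apply: component_mx_iso => //; apply: submx_full.
  by rewrite /row_full -[X in _ == X]rkW card1 mul1n.
pose v := nz_row M.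
have [modM nzM _] := simM.
have nz_v : v != 0%R by rewrite nz_row_eq0.
have vM : (v <= M)%MS := nz_row_sub M.
have Mv : (M <= v)%MS.
  by rewrite -(mxrank_leqif_sup vM) rM1 rank_rV nz_v.
have wt u : u \in U -> exists c, (v *m rG u = c *: v)%R.
  move=> Uu; apply/sub_rVP; apply: submx_trans Mv.
  by apply: submx_trans (submxMr _ vM) _; apply: (mxmoduleP modM).
have [d Dvf] : exists d, (v *m f = d *: (v *m rG x))%R.
  apply/sub_rVP; apply: submx_trans (submxMr f vM) _.
  by rewrite Mfx submxMr.
have nz_d : d != 0%R.
  apply: contraNneq nz_v => d0; move: Dvf; rewrite d0 scale0r => vf0.
  by rewrite -(mulmxK injf v) vf0 mul0mx.
(* v spans a U-line isomorphic to its image under x, so its weight is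
   x-invariant *)
have wtJ u : u \in U -> (v *m rG (u ^ x^-1)%g = v *m rG u)%R.
  move=> Uu; have [c Dc] := wt u Uu; have Hu := subsetP sUH u Uu.
  have homv : (v <= dom_hom_mx rU f)%MS := submx_trans vM homf.
  have /= := hom_mxP homv u Uu; rewrite Dc -scalemxAl Dvf -scalemxAl.
  move/eqP; rewrite scalerA mulrC -scalerA.
  rewrite (inj_eq (scalerI nz_d)) => /eqP Evx.
  apply: (can_inj (repr_mxK rG Hx)).
  rewrite -scalemxAl Evx -!mulmxA -!repr_mxM ?groupJ ?groupV //.
  by rewrite -conjgCV.
apply: contraNeq nz_v => _; apply/eqP/fix0 => w.
rewrite -{1}(regular_commg_surj nUx regx) => /imsetP[u Uu ->].
have Uux : (u ^ x)%g \in U by rewrite memJ_norm.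
have [Hu Hux] := (subsetP sUH u Uu, subsetP sUH _ Uux).
have [c Dc] := wt _ (groupVr Uu).
rewrite commgEl repr_mxM ?groupV // mulmxA Dc -scalemxAl -wtJ // conjgK.
by rewrite scalemxAl -Dc -mulmxA -repr_mxM ?groupV // mulVg repr_mx1 mulmx1.
Qed.

Lemma sum_repr_eq0 (F : fieldType) n (rG : mx_representation F H n) :
  (forall v : 'rV_n, (forall u, u \in U -> v *m rG u = v) -> v = 0)%R ->
  (\sum_(u in U) rG u = 0)%R.
Proof.
move=> fix0; apply/row_matrixP=> i; rewrite row0; apply: fix0 => u Uu.
rewrite -row_mul; congr row; rewrite mulmx_suml.
rewrite [RHS](reindex_inj (mulIg u)) /=.
apply: eq_big => [w | w Uw]; first by rewrite groupMr.
by rewrite repr_mxM ?(subsetP sUH).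
Qed.

(** Over a splitting field the module is a sum of irreducibles, by Maschke, and
    frob_irr_dim applies to each. That U still has no fixed vector is seen on the
    sum of U, which vanishes over 'F_s and therefore over the extension. *)
Lemma frob_module_dim s n (rG : mx_representation 'F_s H n) :
  abelian U -> prime s -> coprime s #|H| ->
  (forall v : 'rV_n, (forall u, u \in U -> v *m rG u = v) -> v = 0)%R ->
  p %| n.
Proof.
move=> cUU s_pr coH fix0.
apply: (@group_closure_field_exists gT 'F_s) => [[F f splitF]].
pose rF := map_repr f rG.
have pcF : s \in [pchar F]%R by rewrite (fmorph_pchar f) pchar_Fp.
have coF m : coprime s m -> (m%:R != 0 :> F)%R.
  by rewrite prime_coprime // (dvdn_pcharf pcF).
have fixF (v : 'rV[F]_n) : (forall u, u \in U -> v *m rF u = v)%R -> v = 0%R.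
  move=> fixv; pose E := (\sum_(u in U) rG u)%R.
  have E0 : E = 0%R := sum_repr_eq0 fix0.
  have: (v *m map_mx f E = 0)%R by rewrite E0 map_mx0 mulmx0.
  rewrite map_mx_sum mulmx_sumr (eq_bigr (fun _ => v)) => [|u Uu]; last exact: fixv.
  rewrite sumr_const -scaler_nat => /eqP; rewrite scaler_eq0 => /orP[|/eqP//].
  have coU : coprime s #|U| by apply: coprime_dvdr coH; apply: cardSg.
  by rewrite (negPf (coF _ coU)).
have pF'H : [pchar F]^'.-group H.
  apply/pgroupP=> r r_pr rH; apply/negP=> /= pcr.
  have: r \in (s : nat_pred) by rewrite -(pcharf_eq pcF).
  by rewrite inE => /eqP Ers; move: coH; rewrite prime_coprime // -Ers rH.
apply: (mx_reducible_semisimple (mxmodule1 rF) (mx_Maschke_pchar rF pF'H)).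
case=> I W /= simW defW dxW.
rewrite -[n](mxrank1 F) -defW (mxdirectP dxW) /=.
apply: dvdn_sum => i _; have [modW _ _] := simW i.
have irrW := submod_mx_irr modW; have [irrWi _] := irrW.
apply: (frob_irr_dim (rG := submod_repr modW)) => //; last by apply/irrW.
move=> v fixv; apply/eqP; rewrite -(val_submod_eq0 v); apply/eqP/fixF => u Uu.
by rewrite -val_submodJ ?(subsetP sUH) // fixv.
Qed.

(** Counting the Frobenius group by the conjugates of <[x]> gives, in the group
    ring, (sum over g in U of the sum of <[x]> conjugated by g)
      = #|U| + (a left multiple of the sum of U).
    The sum of U acts as 0. If x had no fixed vector, the sum of <[x]> would act as
    0 too, and then so would #|U|, which is prime to s. *)
Lemma frob_module_fixed s n (rG : mx_representation 'F_s H n) :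
  prime s -> coprime s #|U| -> 0 < n ->
  (forall v : 'rV_n, (forall u, u \in U -> v *m rG u = v) -> v = 0)%R ->
  exists2 v : 'rV_n, v != 0%R & (v *m rG x = v)%R.
Proof.
move=> s_pr coU n_gt0 fix0.
have E0 := sum_repr_eq0 fix0.
have E0' : (\sum_(u in U) rG u^-1%g = 0)%R.
  rewrite -[RHS]E0 [RHS](reindex_inj invg_inj) /=.
  by apply: eq_bigl => u; rewrite groupV.
pose T := (\sum_(i < p) rG (x ^+ i)%g)%R.
have Tx : (T *m rG x = T)%R.
  have p0 := prime_gt0 p_pr; rewrite /T mulmx_suml.
  rewrite -(prednK p0) big_ord_recr big_ord_recl /= addrC.
  rewrite -repr_mxM ?groupX // -expgSr prednK //.
  have -> : (x ^+ p = x ^+ 0)%g by rewrite -ox expg_order.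
  congr (_ + _)%R; apply: eq_bigr => i _.
  by rewrite -repr_mxM ?groupX // -expgSr.
have [T0 | nzT] := eqVneq T 0%R; last first.
  have /existsP[i nzi] : [exists i, row i T != 0%R].
    apply: contraR nzT; rewrite negb_exists => /forallP T0.
    by apply/eqP/row_matrixP=> i; rewrite row0; apply/eqP; have := T0 i; rewrite negbK.
  by exists (row i T); rewrite // -row_mul Tx.
have pcF : s \in [pchar 'F_s]%R by rewrite pchar_Fp.
have : (\sum_(g in U) rG g^-1%g *m T *m rG g = 0)%R.
  by apply: big1 => g _; rewrite T0 mulmx0 mul0mx.
have -> : (\sum_(g in U) rG g^-1%g *m T *m rG g =
  \sum_(i < p) \sum_(g in U) rG (x ^+ i)%g *m rG [~ g, x ^+ i]^-1%g)%R.
  rewrite exchange_big /=; apply: eq_bigr => g Ug.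
  have Hg := subsetP sUH g Ug.
  rewrite /T mulmx_sumr mulmx_suml; apply: eq_bigr => i _.
  rewrite -!repr_mxM ?groupM ?groupV ?groupR ?groupX //; congr (rG _).
  by rewrite invg_comm commgEl mulKVg conjgE mulgA.
rewrite -(prednK (prime_gt0 p_pr)) big_ord_recl /= [X in (_ + X)%R]big1 => [|i _]; last first.
  rewrite -mulmx_sumr; set y := (x ^+ _)%g.
  have Cy : 'C_U[y] = 1%g.
    have : generator <[x]> y.
      rewrite generator_coprime ox prime_coprime // gtnNdvd //.
      by rewrite -[X in _ < X](prednK (prime_gt0 p_pr)) ltnS /bump leq0n add1n.
    by move/eqP=> Exy; rewrite -cent_cycle -Exy cent_cycle.
  have Ny : y \in 'N(U) by rewrite groupX.
  have imy := regular_commg_surj Ny Cy.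
  have injy : {in U &, injective (fun g => [~ g, y])}.
    by apply/imset_injP; rewrite imy.
  have Es : (\sum_(g in U) rG [~ g, y]^-1%g = 0)%R.
    rewrite -(big_imset (fun u => rG u^-1%g) injy) -[RHS]E0'.
    by apply: eq_bigl => u; rewrite imy.
  by rewrite Es mulmx0.
rewrite addr0 (eq_bigr (fun _ => 1%:M%R)) => [|g _]; last first.
  by rewrite expg0 commg1 invg1 repr_mx1 mulmx1.
rewrite sumr_const -scaler_nat scale_scalar_mx mulr1.
move/matrixP/(_ (Ordinal n_gt0) (Ordinal n_gt0)); rewrite !mxE eqxx mulr1n.
by move/eqP; rewrite -(dvdn_pcharf pcF) -[_ %| _]negbK -prime_coprime // coU.
Qed.
End FrobeniusModule.

Section FrobeniusAbelem.
Variables (gT : finGroupType) (V U : {group gT}) (x : gT) (p s : nat).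
Hypotheses (p_pr : prime p) (s_pr : prime s) (neq_ps : p != s).
Hypotheses (abV : s.-abelem V) (ntV : V :!=: 1%g) (ntU : U :!=: 1%g).
Hypotheses (nUx : x \in 'N(U)) (nVx : x \in 'N(V)) (nVU : U \subset 'N(V)).
Hypotheses (ox : #[x] = p) (regx : 'C_U[x] = 1%g).
Hypotheses (coUp : coprime #|U| p) (coUs : coprime s #|U|) (nilU : nilpotent U).
Hypothesis regU : forall u, u \in U -> u != 1%g -> 'C_V[u] = 1%g.

Let Z := 'Z(U)%G.
Let sZU : Z \subset U. Proof. exact: center_sub. Qed.
Let nZx : x \in 'N(Z).
Proof. by move: nUx; rewrite -!cycle_subG => /(char_norm_trans (center_char U)). Qed.
Let regZx : 'C_Z[x] = 1%g.
Proof. by apply/trivgP; rewrite -regx setSI. Qed.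
Let coZp : coprime #|Z| p.
Proof. exact: coprime_dvdl (cardSg sZU) coUp. Qed.
Let H := (Z <*> <[x]>)%G.
Let nVH : H \subset 'N(V).
Proof. by rewrite join_subG (subset_trans sZU) ?cycle_subG. Qed.
Let rG := abelem_repr abV ntV nVH.
Let sZH : Z \subset H. Proof. exact: joing_subl. Qed.

Let fixZ (v : 'rV_('dim V)) :
  (forall u, u \in Z -> v *m rG u = v)%R -> v = 0%R.
Proof.
move=> fixv; have [u Zu ntu] : exists2 u, u \in Z & u != 1%g.
  by apply/trivgPn; rewrite center_nil_eq1.
have: rVabelem abV ntV v \in 'C_V[u].
  apply/setIP; split; first exact: mem_rVabelem.
  apply/cent1P/commgP/conjg_fixP.
  by rewrite -(rVabelemJ abV ntV nVH) ?(subsetP sZH) ?fixv.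
rewrite (regU (subsetP sZU u Zu) ntu) => /set1P v1.
by apply: (@rVabelem_inj _ _ _ abV ntV); rewrite v1 rVabelem0.
Qed.

(** The center of U replaces U: frob_irr_dim needs the irreducible modules of U
    over a splitting field to be lines. *)
Lemma frob_abelem_dim : p %| logn s #|V|.
Proof.
rewrite -(dim_abelemE abV ntV).
apply: (frob_module_dim nZx p_pr ox coZp regZx (rG := rG) _ s_pr _ fixZ).
  exact: center_abelian.
rewrite (card_frob_join nZx ox) // coprimeMr (coprime_dvdr (cardSg sZU) coUs) /=.
by rewrite prime_coprime // dvdn_prime2 // eq_sym.
Qed.

Lemma frob_abelem_fixed : 'C_V[x] != 1%g.
Proof.
have coZs : coprime s #|Z| := coprime_dvdr (cardSg sZU) coUs.
have [v nzv fixv] := frob_module_fixed nZx p_pr ox regZx s_pr coZs (ltn0Sn _) fixZ.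
have: rVabelem abV ntV v \in 'C_V[x].
  apply/setIP; split; first exact: mem_rVabelem.
  apply/cent1P/commgP/conjg_fixP.
  by rewrite -(rVabelemJ abV ntV nVH) ?fixv // mem_gen // inE cycle_id orbT.
apply: contraTneq => ->; apply: contra nzv => /set1P v1.
by apply/eqP/(@rVabelem_inj _ _ _ abV ntV); rewrite v1 rVabelem0.
Qed.
End FrobeniusAbelem.

(** * Prime pairs without an element of order pq *)

(** Adjacency in the Gruenberg-Kegel graph of G. *)
Definition gk_edge (gT : finGroupType) (G : {set gT}) (p q : nat) : bool :=
  [exists x in G, #[x] == (p * q)%N].

(** The topmost of the chief factors of G whose order involves p or q is a p-group.
    If G is solvable, then for a pair of prime divisors of #|G| without elements of
    order pq this means that a Hall subgroup for p and q is Frobenius or 2-Frobenius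
    with a p-group on top. *)
Definition above (gT : finGroupType) (G : {group gT}) (p q : nat) : bool :=
  [exists K : {group gT}, [&& K <| G, p %| #|G : K| & ~~ (q %| #|G : K|)]].

Section GKEdge.
Variables (gT : finGroupType).
Implicit Types (G H K L V : {group gT}) (p q r s : nat).

Lemma gk_edgeS H G p q : H \subset G -> gk_edge H p q -> gk_edge G p q.
Proof.
move=> sHG /exists_inP[x Hx ox]; apply/exists_inP; exists x => //.
exact: subsetP sHG x Hx.
Qed.

Lemma gk_edge_quotient G K p q :
  0 < p * q -> K <| G -> gk_edge (G / K)%g p q -> gk_edge G p q.
Proof.
move=> pq0 nsKG /exists_inP[_ /morphimP[x Nx Gx ->] /eqP ox].
have dv : p * q %| #[x] by rewrite -ox morph_order.
apply/exists_inP; exists (x ^+ (#[x] %/ (p * q)))%g; first by rewrite groupX.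
by rewrite orderXdiv ?dvdn_div // divnA // mulKn // order_gt0.
Qed.

Lemma gk_edge_commute G p q a b :
  prime p -> prime q -> p != q -> a \in G -> b \in G -> commute a b ->
  p %| #[a] -> q %| #[b] -> gk_edge G p q.
Proof.
move=> p_pr q_pr neq_pq Ga Gb cab pa qb; apply/exists_inP.
exists (a ^+ (#[a] %/ p) * b ^+ (#[b] %/ q))%g; first by rewrite groupM ?groupX.
have oa : #[a ^+ (#[a] %/ p)]%g = p by rewrite orderXdiv ?dvdn_div // divnA // mulKn.
have ob : #[b ^+ (#[b] %/ q)]%g = q by rewrite orderXdiv ?dvdn_div // divnA // mulKn.
rewrite orderM ?oa ?ob //; first exact/commuteX2.
by rewrite prime_coprime // dvdn_prime2.
Qed.

Lemma gk_edge_cent G V s p x :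
  prime p -> prime s -> p != s -> s.-group V -> V \subset G -> x \in G ->
  p %| #[x] -> 'C_V[x] != 1%g -> gk_edge G p s.
Proof.
move=> p_pr s_pr neq_ps sV sVG Gx px /trivgPn[v /setIP[Vv /cent1P cxv] ntv].
apply: (gk_edge_commute p_pr s_pr neq_ps Gx (subsetP sVG v Vv) _ px).
  exact: commute_sym.
have sv : s.-group <[v]> by apply: pgroupS sV; rewrite cycle_subG.
by have [] := pgroup_pdiv sv; rewrite ?cycle_eq1.
Qed.

End GKEdge.

Section Above.
Variables (gT : finGroupType).
Implicit Types (G H K L V : {group gT}) (p q r s : nat).

(** Modulo the intersection of K and L, the normal subgroups K and L commute. *)
Lemma gk_edge_cross G K L p q :
  prime p -> prime q -> p != q -> K <| G -> L <| G ->
  p %| #|L : K| -> q %| #|K : L| -> gk_edge G p q.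
Proof.
move=> p_pr q_pr neq_pq nsKG nsLG pL qK.
have [sKG nKG] := andP nsKG; have [sLG nLG] := andP nsLG.
pose I := (K :&: L)%G; have nsIG : I <| G by apply: normalI.
have nIG := normal_norm nsIG.
have nIK := subset_trans sKG nIG; have nIL := subset_trans sLG nIG.
apply: (gk_edge_quotient _ nsIG); first by rewrite muln_gt0 !prime_gt0.
have pLI : p %| #|(L / I)%g| by rewrite card_quotient //= setIC indexgI.
have qKI : q %| #|(K / I)%g| by rewrite card_quotient //= indexgI.
have [a La oa] := Cauchy p_pr pLI; have [b Kb ob] := Cauchy q_pr qKI.
have sLGI := quotientS I sLG; have sKGI := quotientS I sKG.
apply: (@gk_edge_commute _ (G / I)%G p q a b p_pr q_pr neq_pq
    (subsetP sLGI a La) (subsetP sKGI b Kb)).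
- apply: (centsP _ a La b Kb); rewrite (sameP commG1P trivgP) /=.
  have tiKL : (K / I :&: L / I)%g = 1%g.
    by rewrite -quotientIG ?subsetIr //; apply: (trivg_quotient I).
  rewrite -tiKL subsetI commg_subr commg_subl.
  apply/andP; split; first exact: subset_trans sLGI (quotient_norms _ nKG).
  exact: subset_trans sKGI (quotient_norms _ nLG).
- by rewrite oa.
by rewrite ob.
Qed.

(** Otherwise p divides #|L : K| and q divides #|K : L|, as in gk_edge_cross.
    This lets the witnesses of p above q and of q above s be nested. *)
Lemma index_joing_dvd_above G K L p q :
  prime p -> prime q -> p != q -> ~~ gk_edge G p q -> K <| G -> L <| G ->
  p %| #|G : K| -> ~~ (q %| #|G : K|) -> q %| #|G : L| -> p %| #|G : K <*> L|.
Proof.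
move=> p_pr q_pr neq_pq no_pq nsKG nsLG pK qK qL.
have [sKG nKG] := andP nsKG; have [sLG nLG] := andP nsLG.
have sJG : K <*> L \subset G by rewrite join_subG sKG.
have EK : #|K <*> L : K| = #|L : K|.
  by rewrite norm_joinEr ?(subset_trans sLG) // indexMg.
have EL : #|K <*> L : L| = #|K : L|.
  by rewrite joingC norm_joinEr ?(subset_trans sKG) // indexMg.
apply: contraR no_pq => npJ; apply: (gk_edge_cross p_pr q_pr neq_pq nsKG nsLG).
  move: pK; rewrite -(Lagrange_index sJG (joing_subl K L)) Euclid_dvdM // EK.
  by rewrite (negPf npJ).
move: qL; rewrite -(Lagrange_index sJG (joing_subr K L)) Euclid_dvdM // EL.
move/orP=> [qJ|//]; case/negP: qK.
by rewrite -(Lagrange_index sJG (joing_subl K L)) dvdn_mulr.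
Qed.

Lemma above_asym G p q :
  prime p -> prime q -> p != q -> ~~ gk_edge G p q -> above G p q ->
  ~~ above G q p.
Proof.
move=> p_pr q_pr neq_pq no_pq /existsP[K /and3P[nsKG pK qK]].
apply/negP=> /existsP[L /and3P[nsLG qL]]; case/negP.
have := index_joing_dvd_above p_pr q_pr neq_pq no_pq nsKG nsLG pK qK qL.
move/dvdn_trans; apply.
have sJG : K <*> L \subset G by rewrite join_subG !normal_sub.
by rewrite -(Lagrange_index sJG (joing_subr K L)) dvdn_mulr.
Qed.

(** Take K normal and smallest with #|G : K| prime to pq, and a chief factor
    K / L: it is a group of prime power order, for p or for q. *)
Lemma above_total G p q :
  solvable G -> prime p -> prime q -> p != q -> p %| #|G| ->
  above G p q || above G q p.
Proof.
move=> solG p_pr q_pr neq_pq pG.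
pose P (K : {group gT}) := [&& K <| G, ~~ (p %| #|G : K|) & ~~ (q %| #|G : K|)].
have exP : exists K, P K.
  by exists G; rewrite /P normal_refl indexgg !dvdn1 !gtn_eqF ?prime_gt1.
have [K /mingroupP[/and3P[nsKG npK nqK] minK]] := ex_mingroup exP.
have ntK : K :!=: 1%g by apply: contraNneq npK => ->; rewrite indexg1.
have [L maxL] : {L : {group gT} | maxnormal L K G}.
  by apply: ex_maxgroup; exists 1%G; rewrite proper1G ntK norms1.
have [/andP[pLK nLG] _] := maxgroupP maxL.
have nsLG : L <| G by rewrite /normal nLG (subset_trans (proper_sub pLK)) ?normal_sub.
have := chief_factor_minnormal (introT andP (conj maxL nsKG)) => minKL.
have [_ ntKL /is_abelemP[r r_pr abKL]] :=
  minnormal_solvable minKL (quotientS L (normal_sub nsKG)) (quotient_sol L solG).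
have iL : #|G : L| = (#|G : K| * #|(K / L)%g|)%N.
  rewrite card_quotient ?(subset_trans (normal_sub nsKG)) //.
  by rewrite (Lagrange_index (normal_sub nsKG) (proper_sub pLK)).
have dvr t : prime t -> ~~ (t %| #|G : K|) -> t %| #|G : L| -> t = r.
  move=> t_pr ntK' ; rewrite iL Euclid_dvdM // (negPf ntK') /= => tKL.
  by apply/eqP; have /pgroupP/(_ t t_pr tKL) := abelem_pgroup abKL.
have sLK := proper_sub pLK.
have : ~~ P L by apply: contraL pLK => PL; rewrite (minK _ PL sLK) properxx.
rewrite /P nsLG /= negb_and !negbK => /orP[pL | qL]; apply/orP; [left | right].
  apply/existsP; exists L; rewrite nsLG pL /=; apply: contra neq_pq => qL.
  by rewrite (dvr p) // (dvr q).
apply/existsP; exists L; rewrite nsLG qL /=; apply: contra neq_pq => pL.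
by rewrite (dvr p) // (dvr q).
Qed.
End Above.

(** * Directed paths of primes *)

Section AbovePaths.
Variables (gT : finGroupType).
Implicit Types (G H K L V : {group gT}) (p q r s : nat).

(** By the Frattini argument a Sylow q-subgroup Q of K is normalized by an element
    x of order p. Without elements of order pq and qs, x acts freely on Q and Q
    acts freely on V, so V is a module of a Frobenius group as above. *)
Lemma above_core G V K p q s :
  prime p -> prime q -> prime s -> p != q -> q != s -> p != s ->
  ~~ gk_edge G p q -> ~~ gk_edge G q s ->
  K <| G -> p %| #|G : K| -> ~~ (q %| #|G : K|) -> q %| #|G| ->
  V <| G -> s.-abelem V -> V :!=: 1%g ->
  (p %| logn s #|V|) /\ gk_edge G p s.
Proof.
move=> p_pr q_pr s_pr neq_pq neq_qs neq_ps no_pq no_qs nsKG pK qK qG nsVG abV ntV.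
have [sKG nKG] := andP nsKG; have [sVG nVG] := andP nsVG.
have [Q sylQ] := Sylow_exists q G; have [sQG qQ _] := and3P sylQ.
have sQK : Q \subset K.
  have qGK : q^'.-group (G / K)%g.
    by rewrite /pgroup card_quotient // p'natE.
  rewrite -quotient_sub1 ?(subset_trans sQG) // subG1 trivg_card1.
  have := pnat_coprime (quotient_pgroup K qQ) qGK.
  by rewrite /coprime (gcdn_idPl (cardSg (quotientS K sQG))).
have sylQK : q.-Sylow(K) Q by apply: pHall_subl sylQ.
have defG : (K * 'N_G(Q))%g = G := Frattini_arg nsKG sylQK.
have pN : p %| #|'N_G(Q)|.
  apply: dvdn_trans pK _; rewrite -[G in #|G : _|]defG indexMg.
  exact: dvdn_indexg.
have [x /setIP[Gx nQx] ox] := Cauchy p_pr pN.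
have ntQ : Q :!=: 1%g.
  rewrite -cardG_gt1 (card_Hall sylQ) p_part -(expn0 q) ltn_exp2l ?prime_gt1 //.
  by rewrite logn_gt0 mem_primes q_pr cardG_gt0.
have regx : 'C_Q[x] = 1%g.
  apply: contraNeq no_pq => ntC.
  by apply: (gk_edge_cent p_pr q_pr neq_pq qQ sQG Gx); rewrite ?ox.
have regU u : u \in Q -> u != 1%g -> 'C_V[u] = 1%g.
  move=> Qu ntu; apply: contraNeq no_qs => ntC.
  apply: (gk_edge_cent q_pr s_pr neq_qs (abelem_pgroup abV) sVG (subsetP sQG u Qu)) => //.
  have qu : q.-group <[u]> by apply: pgroupS qQ; rewrite cycle_subG.
  by have [] := pgroup_pdiv qu; rewrite ?cycle_eq1.
have coQ t : prime t -> t != q -> coprime #|Q| t.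
  move=> t_pr neq; have [k ->] := p_natP qQ.
  by rewrite coprimeXl // prime_coprime // dvdn_prime2 // eq_sym.
have nVx : x \in 'N(V) := subsetP nVG x Gx.
have nVQ := subset_trans sQG nVG.
have coQp := coQ p p_pr neq_pq.
have coQs : coprime s #|Q| by rewrite coprime_sym coQ // eq_sym.
have nilQ := pgroup_nil qQ.
split; first exact: (frob_abelem_dim p_pr s_pr neq_ps abV ntV ntQ nQx
    nVx nVQ ox regx coQp coQs nilQ regU).
have ntC := frob_abelem_fixed p_pr s_pr abV ntV ntQ nQx nVx nVQ ox regx coQs nilQ regU.
by apply: (gk_edge_cent p_pr s_pr neq_ps (abelem_pgroup abV) sVG Gx); rewrite ?ox.
Qed.

(** An irreducible E-submodule of V is faithful, and abelian groups with a faithful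
    irreducible module are cyclic. *)
Lemma regular_abelian_cyclic (E V : {group gT}) s :
  s.-abelem V -> V :!=: 1%g -> E \subset 'N(V) -> abelian E ->
  (forall u, u \in E -> u != 1%g -> 'C_V[u] = 1%g) -> cyclic E.
Proof.
move=> abV ntV nVE cEE regE.
have [W minW sWV] := minnormal_exists ntV nVE.
have [_ nWE] := andP (mingroupp minW); have [ntW _] := andP (mingroupp minW).
have abW : s.-abelem W := abelemS sWV abV.
apply: (mx_faithful_irr_abelian_cyclic (rG := abelem_repr abW ntW nWE)) => //.
  apply: abelem_mx_faithful; apply/trivgP/subsetP=> u /setIP[Eu cWu].
  rewrite inE; apply: contraR ntW => ntu.
  rewrite -subG1 -(regE u Eu ntu) subsetI sWV sub_cent1.
  by [].
by apply/abelem_mx_irrP.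
Qed.

(** Such a group is cyclic, or r = 2 and it is of maximal class. In both cases its
    elementary abelian quotients have rank at most 2. *)
Lemma cyclic_or_index2 r (R : {group gT}) :
  r.-group R -> (forall X : {group gT}, X \subset R -> abelian X -> cyclic X) ->
  cyclic R \/ r = 2 /\ exists2 y, y \in R & #|R : <[y]>| = 2.
Proof.
move=> rR cycX; have [X nsXR | | /and3P[/eqP r2 ext _]] := normal_rank1_structure rR.
- exact/cycX/normal_sub.
- by left.
right; split=> //.
have gen n xy : n > 1 -> extremal_generators R 2 n xy ->
    exists2 y, y \in R & #|R : <[y]>| = 2.
  case: xy => x y n_gt1 [oR Rx ox _]; exists x => //.
  rewrite -divgS ?cycle_subG // oR -orderE ox -(prednK (ltnW n_gt1)) /= expnS.
  by rewrite mulnK ?expn_gt0.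
move: ext; rewrite /extremal2 !inE => /or3P[] /eqP.
- case/dihedral_classP=> n n_gt1 iso.
  by have [xy /(gen _ _ n_gt1)] := generators_2dihedral n_gt1 iso.
- case/semidihedral_classP=> n n_gt3 iso.
  by have [xy /(gen _ _ (ltnW (ltnW n_gt3)))] := generators_semidihedral n_gt3 iso.
case/quaternion_classP=> n n_gt2 iso.
by have [xy /(gen _ _ (ltnW n_gt2))] := generators_quaternion n_gt2 iso.
Qed.
End AbovePaths.

Lemma index_quotient_normal (gT : finGroupType) (G K V : {group gT}) :
  V <| G -> V \subset K -> K \subset G -> #|(G / V)%g : (K / V)%g| = #|G : K|.
Proof.
move=> nsVG sVK sKG; apply: index_quotient_eq => //; last exact: normal_norm.
by rewrite subIset // sVK orbT.
Qed.

Lemma gk_edge_quotientN (gT : finGroupType) (G V : {group gT}) p q :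
  prime p -> prime q -> V <| G -> ~~ gk_edge G p q -> ~~ gk_edge (G / V)%G p q.
Proof.
move=> p_pr q_pr nsVG; apply: contra; apply: gk_edge_quotient nsVG.
by rewrite muln_gt0 !prime_gt0.
Qed.

(** All s-chief factors of G lie below L, hence below K, so above_core applies to
    each of them; their dimensions add up to logn s #|G|. *)
Lemma above_chain_dim (gT : finGroupType) (G K L : {group gT}) p q s :
  prime p -> prime q -> prime s -> p != q -> q != s -> p != s ->
  solvable G -> ~~ gk_edge G p q -> ~~ gk_edge G q s ->
  K <| G -> L <| G -> L \subset K ->
  p %| #|G : K| -> ~~ (q %| #|G : K|) -> q %| #|G : L| -> ~~ (s %| #|G : L|) ->
  (p %| logn s #|G|) && ((s %| #|G|) ==> gk_edge G p s).
Proof.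
move=> p_pr q_pr s_pr neq_pq neq_qs neq_ps.
have [n] := ubnP #|G|; elim: n gT G K L => // n IHn gT G K L.
rewrite ltnS => leGn solG no_pq no_qs nsKG nsLG sLK pK qK qL sL.
have [ntL | ntL] := eqVneq (L : {set gT}) 1%g.
  rewrite ntL indexg1 in sL; rewrite (negPf sL) /= andbT.
  by rewrite lognE (negPf sL) !andbF dvdn0.
have [V minV sVL] := minnormal_exists ntL (normal_norm nsLG).
have sVG := subset_trans sVL (normal_sub nsLG); have sVK := subset_trans sVL sLK.
have [nVG ntV /is_abelemP[r r_pr abV]] := minnormal_solvable minV sVG solG.
have nsVG : V <| G by rewrite /normal sVG.
have iq (M : {group gT}) : V \subset M -> M <| G -> #|(G / V)%G : (M / V)%G| = #|G : M|.
  by move=> sVM nsMG; apply: index_quotient_normal => //; apply: normal_sub.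
have /andP[IHd IHe] : (p %| logn s #|(G / V)%g|) &&
    ((s %| #|(G / V)%g|) ==> gk_edge (G / V)%g p s).
  apply: (IHn _ (G / V)%G (K / V)%G (L / V)%G); rewrite ?iq ?quotient_normal ?quotientS //.
  - by apply: leq_trans leGn; rewrite ltn_quotient.
  - exact: quotient_sol.
  - exact: gk_edge_quotientN.
  exact: gk_edge_quotientN.
have oG : #|G| = (#|V| * #|(G / V)%g|)%N by rewrite card_quotient // Lagrange.
rewrite oG lognM ?cardG_gt0 //.
have [Ers | neq_rs] := eqVneq r s.
  rewrite Ers in abV; have qG : q %| #|G| by apply: dvdn_trans qL (dvdn_indexg _ _).
  have [dvV ->] := above_core p_pr q_pr s_pr neq_pq neq_qs neq_ps no_pq no_qs
    nsKG pK qK qG nsVG abV ntV.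
  by rewrite implybT andbT dvdn_addr.
have s'V : ~~ (s %| #|V|).
  apply: contra neq_rs => sV; rewrite eq_sym.
  by have /pgroupP/(_ s s_pr sV) := abelem_pgroup abV.
rewrite lognE (negPf s'V) !andbF add0n IHd /= Euclid_dvdM // (negPf s'V) /=.
apply/implyP=> sGV; apply: (gk_edge_quotient _ nsVG); first by rewrite muln_gt0 !prime_gt0.
by move/implyP: IHe; apply.
Qed.

Lemma above_path_dim (gT : finGroupType) (G : {group gT}) p q s :
  prime p -> prime q -> prime s -> p != q -> q != s -> p != s ->
  solvable G -> ~~ gk_edge G p q -> ~~ gk_edge G q s ->
  above G p q -> above G q s ->
  (p %| logn s #|G|) && ((s %| #|G|) ==> gk_edge G p s).
Proof.
move=> p_pr q_pr s_pr neq_pq neq_qs neq_ps solG no_pq no_qs.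
case/existsP=> K /and3P[nsKG pK qK] /existsP[L /and3P[nsLG qL sL]].
have nsJG : K <*> L <| G by apply: normalY.
apply: (above_chain_dim (K := (K <*> L)%G) (L := L) (q := q)) => //.
- exact: joing_subr.
- exact: (index_joing_dvd_above p_pr q_pr neq_pq no_pq).
apply: contra qK => qJ.
by rewrite -(Lagrange_index (normal_sub nsJG) (joing_subl K L)) dvdn_mulr.
Qed.

(** The Sylow r-subgroup R acts freely on V, so R is cyclic or has a cyclic subgroup
    of index 2. In the normalizer of R, which covers G / L, the pair p, q forms
    a Frobenius group acting on R / Phi(R), whose dimension is thus a positive
    multiple of p. So R is not cyclic, and r = 2; then the dimension is at most 2,
    which forces p = 2 = r. *)
Lemma no_three_path_core (gT : finGroupType) (G K L V : {group gT}) p q r s :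
  prime p -> prime q -> prime r -> prime s ->
  p != q -> q != r -> r != s -> p != r ->
  ~~ gk_edge G p q -> ~~ gk_edge G q r -> ~~ gk_edge G r s ->
  K <| G -> L <| G -> L \subset K ->
  p %| #|G : K| -> ~~ (q %| #|G : K|) -> q %| #|G : L| -> ~~ (r %| #|G : L|) ->
  r %| #|G| -> V <| G -> s.-abelem V -> V :=: 1%g.
Proof.
move=> p_pr q_pr r_pr s_pr neq_pq neq_qr neq_rs neq_pr no_pq no_qr no_rs.
move=> nsKG nsLG sLK pK qK qL rL rG nsVG abV.
apply/eqP; apply: contraT => ntV.
have [R sylR] := Sylow_exists r G; have [sRG rR _] := and3P sylR.
have [sLG nLG] := andP nsLG; have [sKG nKG] := andP nsKG.
have sRL : R \subset L.
  have rGL : r^'.-group (G / L)%g by rewrite /pgroup card_quotient // p'natE.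
  rewrite -quotient_sub1 ?(subset_trans sRG) // subG1 trivg_card1.
  have := pnat_coprime (quotient_pgroup L rR) rGL.
  by rewrite /coprime (gcdn_idPl (cardSg (quotientS L sRG))).
have sylRL : r.-Sylow(L) R by apply: pHall_subl sylR.
have ntR : R :!=: 1%g.
  rewrite -cardG_gt1 (card_Hall sylR) p_part -(expn0 r) ltn_exp2l ?prime_gt1 //.
  by rewrite logn_gt0 mem_primes r_pr cardG_gt0.
have defG : (L * 'N_G(R))%g = G := Frattini_arg nsLG sylRL.
pose N := 'N_G(R)%G.
have sNG : N \subset G by apply: subsetIl.
have nsRN : R <| N by apply: normalSG.
have iN (M : {group gT}) : L \subset M -> M <| G -> #|N : (N :&: M)%g| = #|G : M|.
  move=> sLM nsMG; rewrite indexgI -(indexMg M N); congr #|_ : _|.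
  apply/eqP; rewrite eqEsubset (mul_subG (normal_sub nsMG) sNG) /=.
  by apply: subset_trans (mulSg N sLM); rewrite defG.
pose F := 'Phi(R)%G; have sFR : F \subset R := Phi_sub R.
have nsFN : F <| N := char_normal_trans (Phi_char R) nsRN.
have sRK := subset_trans sRL sLK.
have sFK : F \subset (N :&: K)%G by rewrite subsetI (normal_sub nsFN) (subset_trans sFR).
have nsNK : N :&: K <| N by rewrite /normal subsetIl normsI ?normG // (subset_trans sNG).
have abW : r.-abelem (R / F)%g := Phi_quotient_abelem rR.
have ntW : (R / F)%g != 1%g.
  rewrite -subG1 quotient_sub1; first exact: proper_subn (Phi_proper ntR).
  exact: subset_trans (normal_sub nsRN) (normal_norm nsFN).
have nsWN : (R / F <| N / F)%g by apply: quotient_normal.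
have qN : q %| #|(N / F)%G|.
  apply: (@dvdn_trans #|(N / F)%G : ((N :&: L) / F)%G|); last exact: dvdn_indexg.
  rewrite index_quotient_normal ?iN ?subsetIl //.
  by rewrite subsetI (normal_sub nsFN) (subset_trans sFR).
have no_gk a b : prime a -> prime b -> ~~ gk_edge G a b -> ~~ gk_edge (N / F)%G a b.
  move=> a_pr b_pr no; apply: gk_edge_quotientN => //.
  by apply: contra no; apply: gk_edgeS.
have iNK : #|(N / F)%G : ((N :&: K) / F)%G| = #|G : K|.
  by rewrite index_quotient_normal ?iN ?subsetIl.
have pNK : p %| #|(N / F)%G : ((N :&: K) / F)%G| by rewrite iNK.
have qNK : ~~ (q %| #|(N / F)%G : ((N :&: K) / F)%G|) by rewrite iNK.
have [dimW _] := above_core (G := (N / F)%G) (V := (R / F)%G) (K := ((N :&: K) / F)%G)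
    p_pr q_pr r_pr neq_pq neq_qr neq_pr (no_gk _ _ p_pr q_pr no_pq)
    (no_gk _ _ q_pr r_pr no_qr) (quotient_normal _ nsNK) pNK qNK qN nsWN abW ntW.
have [_ _ [k oW]] := pgroup_pdiv (abelem_pgroup abW) ntW.
rewrite oW pfactorK // in dimW.
have k1 : 1 < k.+1 by apply: leq_trans (prime_gt1 p_pr) (dvdn_leq _ dimW).
have cycX (X : {group gT}) : X \subset R -> abelian X -> cyclic X.
  move=> sXR cXX; have sXG := subset_trans sXR sRG.
  apply: (regular_abelian_cyclic abV ntV _ cXX).
    exact: subset_trans sXG (normal_norm nsVG).
  move=> u Xu ntu; apply: contraNeq no_rs => ntC.
  apply: (gk_edge_cent r_pr s_pr neq_rs (abelem_pgroup abV) (normal_sub nsVG)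
    (subsetP sXG u Xu)) => //.
  have ru : r.-group <[u]> by apply: pgroupS rR; rewrite cycle_subG (subsetP sXR).
  by have [] := pgroup_pdiv ru; rewrite ?cycle_eq1.
have cyc_bound (C : {group gT}) : cyclic C -> C \subset R -> #|(C / F)%g| %| r.
  move=> cycC sCR; have cCF := quotient_cyclic F cycC.
  have abC := abelemS (quotientS F sCR) abW.
  by move: cCF; rewrite (abelem_cyclic abC) => ?;
  rewrite (card_pgroup (abelem_pgroup abC)) -{3}(expn1 r) dvdn_exp2l.
have [cycR | [r2 [y Ry iy]]] := cyclic_or_index2 rR cycX.
  have := cyc_bound R cycR (subxx _); rewrite oW -{2}(expn1 r) dvdn_Pexp2l ?prime_gt1 //.
  by rewrite leqNgt k1.
have yW := cyc_bound <[y]>%G (cycle_cyclic y) _; rewrite cycle_subG in yW.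
have oW4 : #|(R / F)%g| %| 4.
  rewrite -(Lagrange (quotientS F (_ : <[y]>%G \subset R))) ?cycle_subG //.
  rewrite -[4]/(2 * 2)%N dvdn_mul //; first by rewrite -r2 yW.
  by rewrite -iy index_quotient // subIset // gFnorm.
have k2 : k.+1 <= 2.
  by move: oW4; rewrite oW r2 -[4]/(2 ^ 2)%N dvdn_Pexp2l.
case/negP: neq_pr; rewrite r2 eqn_leq prime_gt1 // andbT.
exact: leq_trans (dvdn_leq _ dimW) k2.
Qed.

(** A minimal normal subgroup below the witness J of r above s either is an s-group,
    which no_three_path_core excludes, or can be factored out. *)
Lemma no_three_path (gT : finGroupType) (G : {group gT}) p q r s :
  prime p -> prime q -> prime r -> prime s ->
  p != q -> q != r -> r != s -> p != r -> q != s ->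
  solvable G -> ~~ gk_edge G p q -> ~~ gk_edge G q r -> ~~ gk_edge G r s ->
  above G p q -> above G q r -> above G r s -> ~~ (s %| #|G|).
Proof.
move=> p_pr q_pr r_pr s_pr neq_pq neq_qr neq_rs neq_pr neq_qs solG no_pq no_qr no_rs.
case/existsP=> K0 /and3P[nsK0G pK0 qK0] /existsP[L0 /and3P[nsL0G qL0 rL0]].
case/existsP=> J /and3P[nsJG rJ sJ].
have nsLG : L0 <*> J <| G by apply: normalY.
have qL := index_joing_dvd_above q_pr r_pr neq_qr no_qr nsL0G nsJG qL0 rL0 rJ.
have rL : ~~ (r %| #|G : L0 <*> J|).
  apply: contra rL0 => rL.
  by rewrite -(Lagrange_index (normal_sub nsLG) (joing_subl L0 J)) dvdn_mulr.
have {nsLG qL rL} [L [nsLG qL rL sJL]] : exists L : {group gT},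
    [/\ L <| G, q %| #|G : L|, ~~ (r %| #|G : L|) & J \subset L].
  by exists (L0 <*> J)%G; split=> //; apply: joing_subr.
have nsKG : K0 <*> L <| G by apply: normalY.
have pK := index_joing_dvd_above p_pr q_pr neq_pq no_pq nsK0G nsLG pK0 qK0 qL.
have qK : ~~ (q %| #|G : K0 <*> L|).
  apply: contra qK0 => qK.
  by rewrite -(Lagrange_index (normal_sub nsKG) (joing_subl K0 L)) dvdn_mulr.
have {nsKG pK qK} [K [nsKG pK qK sLK]] : exists K : {group gT},
    [/\ K <| G, p %| #|G : K|, ~~ (q %| #|G : K|) & L \subset K].
  by exists (K0 <*> L)%G; split=> //; apply: joing_subr.
have [n] := ubnP #|G|.
elim: n gT G solG no_pq no_qr no_rs J L K nsJG rJ sJ nsLG qL rL sJL nsKG pK qK sLK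
  {K0 L0 nsK0G pK0 qK0 nsL0G qL0 rL0} => // n IHn gT G solG no_pq no_qr no_rs.
move=> J L K nsJG rJ sJ nsLG qL rL sJL nsKG pK qK sLK.
rewrite ltnS => leGn.
have [ntJ | ntJ] := eqVneq (J : {set gT}) 1%g; first by rewrite ntJ indexg1 in sJ.
have [V minV sVJ] := minnormal_exists ntJ (normal_norm nsJG).
have sVG := subset_trans sVJ (normal_sub nsJG).
have sVL := subset_trans sVJ sJL; have sVK := subset_trans sVL sLK.
have [nVG ntV /is_abelemP[t t_pr abV]] := minnormal_solvable minV sVG solG.
have nsVG : V <| G by rewrite /normal sVG.
have iq (M : {group gT}) : V \subset M -> M <| G -> #|(G / V)%G : (M / V)%G| = #|G : M|.
  by move=> sVM nsMG; apply: index_quotient_normal => //; apply: normal_sub.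
have [Ets | neq_ts] := eqVneq t s.
  rewrite Ets in abV; case/eqP: ntV.
  have rG : r %| #|G| := dvdn_trans rJ (dvdn_indexg _ _).
  exact: (no_three_path_core p_pr q_pr r_pr s_pr neq_pq neq_qr neq_rs neq_pr
    no_pq no_qr no_rs nsKG nsLG sLK pK qK qL rL rG nsVG abV).
have s'V : ~~ (s %| #|V|).
  apply: contra neq_ts => sV; rewrite eq_sym.
  by have /pgroupP/(_ s s_pr sV) := abelem_pgroup abV.
have s'GV : ~~ (s %| #|(G / V)%G|).
  apply: (IHn _ (G / V)%G _ _ _ _ (J / V)%G (L / V)%G (K / V)%G);
    rewrite ?iq ?quotient_normal ?quotientS //.
  - exact: quotient_sol.
  - exact: gk_edge_quotientN.
  - exact: gk_edge_quotientN.
  - exact: gk_edge_quotientN.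
  by apply: leq_trans leGn; rewrite ltn_quotient.
by rewrite -(Lagrange sVG) -card_quotient // Euclid_dvdM // negb_or s'V.
Qed.

(** * The coloring attached to a solvable group *)

Section Forward.
Variables (n : nat) (F : sgraph) (gT : finGroupType) (G : {group gT}).
Hypotheses (solG : solvable G) (freeG : power_free n #|G|).
Variable f : F -> cod_graph G.
Hypotheses (bij_f : bijective f) (edge_f : forall u v, edge (f u) (f v) = edge u v).

Let P (u : F) : nat := val (f u).

Let P_prime u : prime (P u).
Proof. by have /mem_cod_primes[] := valP (f u). Qed.

Let P_dvd u : P u %| #|G|.
Proof.
have /mem_cod_primes[_ [_ /mapP[i _ ->] Pi]] := valP (f u).
exact: dvdn_trans Pi (codegree_dvd_card i).
Qed.

Let P_inj : injective P.
Proof. by move=> u v /val_inj/(bij_inj bij_f). Qed.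

Let cedge (u v : F) : bool := @compl_edge F u v.

Let cedgeC u v : cedge u v = cedge v u.
Proof. exact: compl_edge_sym. Qed.

Let P_neq u v : cedge u v -> P u != P v.
Proof. by case/andP=> neq_uv _; rewrite (inj_eq P_inj). Qed.

Let no_gk u v : cedge u v -> ~~ gk_edge G (P u) (P v).
Proof.
move=> cuv; have neqP := P_neq cuv; case/andP: cuv => _.
apply: contra => /exists_inP[x Gx /eqP ox]; rewrite -edge_f.
have [i dvi] := exists_codegree_order_mul solG Gx (P_prime u) (P_prime v) neqP ox.
apply/andP; split; first by apply: contraNneq neqP => fuv; rewrite /P fuv.
by apply/hasP; exists (codegree i) => //; apply/mapP; exists i; rewrite ?mem_enum.
Qed.

Let arrow (u v : F) : bool := cedge u v && above G (P u) (P v).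

Let arrow_total u v : cedge u v -> arrow u v || arrow v u.
Proof.
move=> cuv; rewrite /arrow (cedgeC v) cuv /=.
exact: above_total solG (P_prime u) (P_prime v) (P_neq cuv) (P_dvd u).
Qed.

Let arrow_asym u v : arrow u v -> arrow v u -> False.
Proof.
case/andP=> cuv auv /andP[_ avu].
by have := above_asym (P_prime u) (P_prime v) (P_neq cuv) (no_gk cuv) auv; rewrite avu.
Qed.

Let arrow2_neq u v w : arrow u v -> arrow v w -> P u != P w.
Proof.
move=> auv avw; rewrite (inj_eq P_inj); apply/eqP=> Euw.
by rewrite -Euw in avw; apply: arrow_asym auv avw.
Qed.

Let arrow2_dim u v w : arrow u v -> arrow v w ->
  (P u %| logn (P w) #|G|) && ~~ cedge u w.
Proof.
move=> auv avw; have neq_uw := arrow2_neq auv avw.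
case/andP: auv avw => cuv auv /andP[cvw avw].
have /andP[dv gk] := above_path_dim (P_prime u) (P_prime v) (P_prime w) (P_neq cuv)
  (P_neq cvw) neq_uw solG (no_gk cuv) (no_gk cvw) auv avw.
rewrite dv; apply/negP=> /no_gk; rewrite (implyP gk) //; exact: P_dvd.
Qed.

Let arrow3 u v w t : arrow u v -> arrow v w -> arrow w t -> False.
Proof.
move=> auv avw awt; have neq_uw := arrow2_neq auv avw; have neq_vt := arrow2_neq avw awt.
case/andP: auv avw awt => cuv auv /andP[cvw avw] /andP[cwt awt].
have := no_three_path (P_prime u) (P_prime v) (P_prime w) (P_prime t) (P_neq cuv)
  (P_neq cvw) (P_neq cwt) neq_uw neq_vt solG (no_gk cuv) (no_gk cvw) (no_gk cwt) auv avw awt.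
by rewrite P_dvd.
Qed.

(** An orientation of a triangle contains a directed path with two arrows, whose
    ends arrow2_dim makes non-adjacent. *)
Lemma cod_graph_triangle_free : triangle_free (complement F).
Proof.
have no2 a b c : arrow a b -> arrow b c -> cedge a c -> False.
  by move=> ab bc ac; have := arrow2_dim ab bc; rewrite ac andbF.
move=> u v w [/= cuv cvw cuw]; rewrite -/(cedge _ _) in cuv cvw cuw.
have [cvu cwv cwu] : [/\ cedge v u, cedge w v & cedge w u].
  by rewrite !(cedgeC w) cedgeC.
case/orP: (arrow_total cuv) (arrow_total cvw) (arrow_total cuw) => [uv|vu].
  case/orP=> [vw|wv]; first by move=> _; apply: (no2 u v w).
  by case/orP=> [uw|wu]; [apply: (no2 u w v) | apply: (no2 w u v)].
case/orP=> [vw|wv]; last by move=> _; apply: (no2 w v u).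
by case/orP=> [uw|wu]; [apply: (no2 v u w) | apply: (no2 v w u)].
Qed.

(** Vertices on no arrow get Red: they are sources. *)
Definition source_sink_color (u : complement F) : color :=
  if ~~ [exists v, arrow v u] then Red
  else if ~~ [exists v, arrow u v] then Blue else Green.

Let color_red u v : source_sink_color u = Red -> arrow v u -> False.
Proof.
rewrite /source_sink_color => cu vu.
have ex : [exists t, arrow t u] by apply/existsP; exists v.
by rewrite ex /= in cu; case: ifP cu.
Qed.

Let color_blue u v : source_sink_color u = Blue -> arrow u v -> False.
Proof.
rewrite /source_sink_color => cu uv; case: ifP cu => // _.
by have -> : [exists t, arrow u t] by apply/existsP; exists v.
Qed.

Let color_green u : source_sink_color u = Green ->
  (exists v, arrow v u) /\ exists v, arrow u v.
Proof.
rewrite /source_sink_color.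
case ein: [exists v, arrow v u] => //=; case eout: [exists v, arrow u v] => //= _.
by split; apply/existsP.
Qed.

(** Two green ends of an arrow would extend it to a path with three arrows. In this
    coloring the canonical orientation is the given one, so if a blue vertex w is
    reached from all red vertices of pi, then the product of pi divides the exponent
    of the prime of w in #|G|, which is less than n. *)
Lemma cod_graph_coloring :
  exists (c : complement F -> color) (l : complement F -> nat),
     [/\ proper_coloring c, red_labeling c l & bounded_two_paths c n l].
Proof.
exists source_sink_color, P; split.
- have aux u v : arrow u v -> source_sink_color u <> source_sink_color v.
    move=> uv; case Ev : (source_sink_color v) => Eu.
    + exact: color_red Ev uv.
    + have [[a au] _] := color_green Eu; have [_ [b vb]] := color_green Ev.
      exact: arrow3 au uv vb.
    exact: color_blue Eu uv.
  move=> u v /= cuv; case/orP: (arrow_total cuv) => [uv|vu]; first exact: aux.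
  by move=> E; apply: (aux v u).
- by split=> [u _ | u v _ _]; [apply: P_prime | apply: P_inj].
move=> pi uniq_pi redpi le_n [w cw two_w].
have dvd_pi p : p \in pi -> p %| logn (P w) #|G|.
  move=> pi_p; have [u cu lu] := redpi p pi_p.
  rewrite -lu in pi_p; have [v [/andP[/= cuv uv] /andP[/= cvw vw]]] := two_w u cu pi_p.
  have cv : source_sink_color v = Green.
    by move: uv vw; rewrite cu cw; case: (source_sink_color v).
  rewrite -lu; have [auv|avu] := orP (arrow_total cuv); last by case: (color_red cu avu).
  have [avw|awv] := orP (arrow_total cvw); last by case: (color_blue cw awv).
  by have /andP[] := arrow2_dim auv avw.
have pr_pi p : p \in pi -> prime p.
  by move=> pi_p; have [u _ <-] := redpi p pi_p; apply: P_prime.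
have dvd_prod : \prod_(p <- pi) p %| logn (P w) #|G|.
  elim: pi uniq_pi dvd_pi pr_pi {redpi le_n two_w} => [|p pi IHpi] /=.
    by rewrite big_nil dvd1n.
  case/andP=> pi'p uniq_pi dvd_pi pr_pi; rewrite big_cons Gauss_dvd.
    rewrite dvd_pi ?mem_head // IHpi // => q pi_q; first by rewrite dvd_pi // in_cons pi_q orbT.
    by rewrite pr_pi // in_cons pi_q orbT.
  rewrite prime_coprime ?pr_pi ?mem_head // Euclid_dvd_prod ?pr_pi ?mem_head //.
  apply/negP; rewrite big_has => /hasP[q pi_q].
  rewrite dvdn_prime2 ?pr_pi ?mem_head ?in_cons ?pi_q ?orbT // => /eqP Epq.
  by rewrite Epq pi_q in pi'p.
have [G_gt0 /(_ _ (P_prime w))] := freeG; rewrite pfactor_dvdn ?P_prime // => /negP; apply.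
apply: leq_trans le_n (dvdn_leq _ dvd_prod).
by rewrite logn_gt0 mem_primes P_prime G_gt0 P_dvd.
Qed.
End Forward.

(** * Primes congruent to 1 and roots of unity *)

(** A prime divisor p of a value at x of the m-th cyclotomic polynomial, with x
    divisible by m and by B`!, does not divide m and exceeds B. The order of x modulo
    p is m, as a smaller order d would make x a double root of 'X^m - 1. *)
Lemma prime_1_mod (m B : nat) :
  0 < m -> exists p, [&& prime p, B < p & m %| p.-1].
Proof.
move=> m_gt0.
pose a k := (m * B`! * k.+2)%N.
have a_gt1 k : 1 < a k.
  by rewrite /a (leq_trans _ (leq_pmull k.+2 _)) // muln_gt0 m_gt0 fact_gt0.
(* the value is a unit at finitely many arguments only *)
have [k nk] : exists k, (('Phi_m).[(a k)%:Z] ^+ 2 != 1)%R.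
  pose g := ('Phi_m ^+ 2 - 1 : {poly int})%R.
  have sPhi : 1 < size 'Phi_m by rewrite size_Cyclotomic ltnS totient_gt0.
  have nz_g : g != 0%R.
    rewrite subr_eq0; apply: contraTneq sPhi => E.
    have := congr1 (fun q : {poly int} => (size q).-1) E.
    by rewrite size_poly1 size_exp => /eqP; rewrite muln_eq0 orbF; case: (size _) => [|[]].
  pose rs := [seq (a k)%:Z%R | k <- iota 0 (size g)].
  have urs : uniq rs.
    rewrite map_inj_uniq ?iota_uniq // => i j [] /eqP.
    by rewrite eqn_pmul2l ?muln_gt0 ?m_gt0 ?fact_gt0 // => /eqP[].
  have : ~~ all (root g) rs.
    apply/negP=> /(max_poly_roots nz_g)/(_ urs).
    by rewrite size_map size_iota ltnn.
  case/allPn=> _ /mapP[k _ ->]; rewrite rootE !hornerE subr_eq0 => nk.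
  by exists k.
set N := ('Phi_m).[_]%R in nk.
have N_dvd : exists c, ((a k)%:Z ^+ m - 1 = N * c)%R.
  exists (\prod_(d <- rem m (divisors m)) 'Phi_d).[(a k)%:Z]%R.
  rewrite /N -hornerM.
  have <- : (\prod_(d <- divisors m) 'Phi_d
           = 'Phi_m * \prod_(d <- rem m (divisors m)) 'Phi_d)%R.
    by rewrite (big_rem m) // -dvdn_divisors.
  by rewrite prod_Cyclotomic // !hornerE.
have [c Dc] := N_dvd.
have N1 : `|N|%N != 1%N.
  apply: contra nk => /eqP N1.
  by rewrite -[(N ^+ 2)%R]real_normK ?num_real // -abszE N1.
have N0 : `|N|%N != 0%N.
  rewrite absz_eq0; apply/eqP=> N_0.
  have : (1 < (a k)%:Z ^+ m)%R by rewrite exprn_egt1 ?ltz_nat ?a_gt1 // -lt0n.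
  by rewrite -subr_gt0 Dc N_0 mul0r ltxx.
pose p := pdiv `|N|%N.
have p_pr : prime p by rewrite pdiv_prime // ltn_neqAle eq_sym N1 lt0n.
have pcp := pchar_Fp p_pr.
pose x := ((a k)%:R : 'F_p)%R.
have N_p : (N%:~R = 0 :> 'F_p)%R.
  rewrite [N]intEsign rmorphMsign; apply/eqP; rewrite mulf_eq0 signr_eq0 /=.
  by rewrite -[X in (X == 0)%R]/(`|N|%:R)%R -(dvdn_pcharf pcp) pdiv_dvd.
have xm1 : (x ^+ m = 1)%R.
  have := congr1 (fun z : int => z%:~R : 'F_p)%R Dc.
  rewrite /= [RHS]intrM N_p mul0r rmorphB rmorphXn /= => /eqP.
  by rewrite subr_eq0 => /eqP.
have nz_x : x != 0%R.
  by apply: contra_eq_neq xm1 => ->; rewrite expr0n (gtn_eqF m_gt0) eq_sym oner_eq0.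
have p_a : ~~ (p %| a k) by rewrite (dvdn_pcharf pcp).
have p_m : ~~ (p %| m) by apply: contra p_a => pm; rewrite /a -mulnA dvdn_mulr.
have ltBp : B < p.
  rewrite ltnNge; apply: contra p_a => leB; rewrite /a mulnAC dvdn_mull //.
  by rewrite dvdn_fact // prime_gt0.
exists p; rewrite p_pr ltBp /=.
have [d prim_d d_m] := prim_order_exists m_gt0 xm1.
pose phi (q : {poly int}) : {poly 'F_p} := map_poly intr q.
have Phi_x : root (phi 'Phi_m) x.
  by rewrite rootE -[x]/((a k)%:Z%:~R)%R horner_map /= N_p.
have [Edm | neq_dm] := eqVneq d m.
  rewrite -Edm -subn1 (prim_order_dvd prim_d); apply/eqP.
  apply: (mulfI nz_x); rewrite -exprS subn1 prednK ?prime_gt0 // mulr1.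
  by rewrite -[X in (x ^+ X)%R](card_Fp p_pr) expf_card.
(* otherwise x would be a double root of 'X^m - 1 *)
have d_gt0 : 0 < d by apply: dvdn_gt0 d_m.
have root_d : root (phi (\prod_(e <- divisors d) 'Phi_e)%R) x.
  rewrite prod_Cyclotomic // /phi rmorphB rmorph1 /= map_polyXn.
  by rewrite rootE !hornerE (prim_expr_order prim_d) subrr.
have [h Dh] : exists h, (phi ('X^m - 1) = phi 'Phi_m * h * phi (\prod_(e <- divisors d) 'Phi_e))%R.
  pose r := [seq e <- divisors m | (e != m) && ~~ (e %| d)].
  exists (phi (\prod_(e <- r) 'Phi_e))%R; rewrite /phi -!rmorphM /=; congr (map_poly _ _).
  rewrite -prod_Cyclotomic // (bigID (fun e => e %| d)) /= mulrC.
  rewrite -big_filter (bigD1_seq m) /=; first last.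
  - by rewrite filter_uniq // divisors_uniq.
  - rewrite mem_filter -dvdn_divisors // dvdnn andbT.
    by apply: contra neq_dm => md; rewrite eqn_dvd d_m.
  congr (_ * _ * _)%R.
    by rewrite big_filter_cond /r big_filter; apply: eq_bigl => e; rewrite andbC.
  rewrite -big_filter; apply: perm_big; apply: uniq_perm.
  - by rewrite filter_uniq // divisors_uniq.
  - exact: divisors_uniq.
  move=> e; rewrite mem_filter -!dvdn_divisors //.
  by apply: andb_idr => /dvdn_trans; apply.
have := congr1 (fun q : {poly 'F_p} => (q^`()).[x])%R Dh.
rewrite /= /phi rmorphB rmorph1 /= map_polyXn !derivE !hornerE.
move/rootP: Phi_x => Phi_x; move/rootP: root_d => root_d.
rewrite /phi /= in Phi_x root_d.
rewrite Phi_x root_d !(mul0r, mulr0, addr0, add0r).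
rewrite subr0 hornerMn hornerXn => /eqP; rewrite -mulr_natl
  mulf_eq0 expf_eq0 (negPf nz_x) andbF orbF.
by rewrite -(dvdn_pcharf pcp) (negPf p_m).
Qed.

(** Enumerate I and iterate the choice of a larger prime. *)
Lemma prime_family_1_mod (I : finType) (m B : nat) :
  0 < m -> exists2 P : I -> nat, injective P &
    forall i, [&& prime (P i), B < P i & m %| (P i).-1].
Proof.
move=> m_gt0; pose next b := xchoose (prime_1_mod b m_gt0).
have nextP b : [&& prime (next b), b < next b & m %| (next b).-1].
  exact: (xchooseP (prime_1_mod b m_gt0)).
pose h k := iter k next B.
have lt_h : {homo h : i j / i < j}.
  by apply: homo_ltn ltn_trans _ => k; have /and3P[] := nextP (h k).
exists (fun i => h (enum_rank i).+1) => [i j | i].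
  have [lt|lt|E _] := ltngtP (enum_rank i) (enum_rank j).
  - have : h (enum_rank i).+1 < h (enum_rank j).+1 by apply: lt_h.
    by move=> /[swap] ->; rewrite ltnn.
  - have : h (enum_rank j).+1 < h (enum_rank i).+1 by apply: lt_h.
    by move=> /[swap] ->; rewrite ltnn.
  by apply/enum_rank_inj/val_inj.
have /and3P[-> _ ->] := nextP (h (enum_rank i)); rewrite /= andbT.
by have := lt_h 0 (enum_rank i).+1 (ltn0Sn _).
Qed.

Definition Fp_prim_root (p e : nat) : 'F_p :=
  odflt 1%R [pick w : 'F_p | e.-primitive_root%R w].

Lemma Fp_prim_rootP p e :
  prime p -> e %| p.-1 -> e.-primitive_root%R (Fp_prim_root p e).
Proof.
move=> p_pr e_p; rewrite /Fp_prim_root; case: pickP => //= no_root.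
have p1 : 0 < p.-1 by rewrite -ltnS prednK ?prime_gt0 ?prime_gt1.
pose rs := [seq x <- enum 'F_p | x != 0%R].
have /hasP[z _ prim_z] : has (p.-1).-primitive_root%R rs.
  apply: has_prim_root => //.
  - apply/allP=> x; rewrite mem_filter => /andP[nzx _].
    rewrite unity_rootE; apply/eqP/(mulfI nzx).
    rewrite -exprS prednK ?prime_gt0 // mulr1.
    by rewrite -[X in (x ^+ X)%R](card_Fp p_pr) expf_card.
  - by rewrite filter_uniq // enum_uniq.
  rewrite size_filter -subn1 leq_subLR.
  have := count_predC (pred1 0%R) (enum 'F_p).
  rewrite -cardE (card_Fp p_pr) count_uniq_mem ?enum_uniq // mem_enum => E.
  by rewrite -[X in X <= _]E.
by have := no_root (z ^+ (p.-1 %/ e))%R; rewrite (dvdn_prim_root prim_z e_p).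
Qed.

(** * Semidirect products with monomial modules *)

(** For each i, a right action of K on the functions from 'I_(mdim i) to 'F_(mprime i)
    given by (a . k) t = mscal k t * a (mshift k t); the four laws say that this is
    an action. *)
Record monomial_family (I : finType) (K : finGroupType) := MonomialFamily {
  mprime : I -> nat;
  mdim : I -> nat;
  mshift : forall i, K -> 'I_(mdim i) -> 'I_(mdim i);
  mscal : forall i, K -> 'I_(mdim i) -> 'F_(mprime i);
  mshift1 : forall i t, mshift (i := i) 1%g t = t;
  mshiftM : forall i (k k' : K) t, mshift (i := i) (k * k')%g t = mshift k (mshift k' t);
  mscal1 : forall i t, mscal (i := i) 1%g t = 1%R;
  mscalM : forall i (k k' : K) t,
    mscal (i := i) (k * k')%g t = (mscal k' t * mscal k (mshift k' t))%R
}.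

Section MonomialSdprod.
Variables (I : finType) (K : finGroupType) (M : monomial_family I K).

Local Notation mcoord i := {ffun 'I_(mdim M i) -> 'F_(mprime M i)}.
Definition mvector := {dffun forall i : I, mcoord i}.
Definition msdprod : Type := (mvector * K)%type.

HB.instance Definition _ := Finite.on msdprod.

Definition mact1 (i : I) (a : mcoord i) (k : K) : mcoord i :=
  [ffun t => (mscal k t * a (mshift k t))%R].

Lemma mact1_1 i (a : mcoord i) : mact1 a 1%g = a.
Proof. by apply/ffunP=> t; rewrite ffunE mscal1 mshift1 mul1r. Qed.

Lemma mact1M i (a : mcoord i) k k' : mact1 a (k * k')%g = mact1 (mact1 a k) k'.
Proof. by apply/ffunP=> t; rewrite !ffunE mscalM mshiftM mulrA. Qed.

Lemma mact1D i (a b : mcoord i) k : (mact1 (a + b) k = mact1 a k + mact1 b k)%R.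
Proof. by apply/ffunP=> t; rewrite !ffunE mulrDr. Qed.

Lemma mact10 i k : mact1 (0 : mcoord i)%R k = 0%R.
Proof. by apply/ffunP=> t; rewrite !ffunE mulr0. Qed.

Lemma mact1N i (a : mcoord i) k : (mact1 (- a) k = - mact1 a k)%R.
Proof. by apply/ffunP=> t; rewrite !ffunE mulrN. Qed.

Definition msd_mul (x y : msdprod) : msdprod :=
  ([ffun i => mact1 (x.1 i) y.2 + y.1 i]%R, x.2 * y.2)%g.
Definition msd_one : msdprod := ([ffun i => 0%R], 1%g).
Definition msd_inv (x : msdprod) : msdprod :=
  ([ffun i => - mact1 (x.1 i) x.2^-1]%R, x.2^-1)%g.

Fact msd_mulA : associative msd_mul.
Proof.
move=> x y z; congr pair; last exact: mulgA.
by apply/ffunP=> i; rewrite !ffunE /= mact1M mact1D addrA.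
Qed.

Fact msd_mul1 : left_id msd_one msd_mul.
Proof.
move=> [f k]; congr pair; last exact: mul1g.
by apply/ffunP=> i; rewrite !ffunE mact10 add0r.
Qed.

Fact msd_mulV : left_inverse msd_one msd_inv msd_mul.
Proof.
move=> [f k]; congr pair; last exact: mulVg.
by apply/ffunP=> i; rewrite !ffunE /= mact1N -mact1M mulVg mact1_1 addNr.
Qed.

HB.instance Definition _ := Finite_isGroup.Build msdprod msd_mulA msd_mul1 msd_mulV.

Lemma msdMg1 (x y : msdprod) i : (x * y)%g.1 i = (mact1 (x.1 i) y.2 + y.1 i)%R.
Proof. by rewrite ffunE. Qed.

Lemma msdMg2 (x y : msdprod) : (x * y)%g.2 = (x.2 * y.2)%g.
Proof. by []. Qed.

Lemma msdV1 (x : msdprod) i : (x^-1)%g.1 i = (- mact1 (x.1 i) x.2^-1)%R.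
Proof. by rewrite ffunE. Qed.

Lemma msd1E i : (1%g : msdprod).1 i = 0%R.
Proof. by rewrite ffunE. Qed.

Lemma msdP (x y : msdprod) : (forall i, x.1 i = y.1 i) -> x.2 = y.2 -> x = y.
Proof. by case: x y => [f k] [g l] /= /ffunP-> ->. Qed.

Fact mproj_morph : {in [set: msdprod] &, {morph (fun x : msdprod => x.2) : x y / (x * y)%g}}.
Proof. by []. Qed.
Canonical mproj_morphism := Morphism mproj_morph.

Definition minj (k : K) : msdprod := ([ffun i => 0%R], k).

Lemma minjM : {morph minj : k l / (k * l)%g}.
Proof. by move=> k l; apply: msdP => // i; rewrite msdMg1 !ffunE mact10 addr0. Qed.
Canonical minj_morphism := @Morphism _ _ [set: K] minj (in2W minjM).

Lemma minj_inj : injective minj.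
Proof. by move=> k l []. Qed.

Lemma order_minj k : #[minj k] = #[k].
Proof.
have inj : 'injm minj_morphism by apply/injmP=> ? ? _ _ /minj_inj.
by rewrite -(order_injm inj) ?inE.
Qed.

Definition msingle (i : I) (a : mcoord i) : msdprod :=
  ([ffun j => dfwith (fun k => 0%R : mcoord k) a j], 1%g).

Lemma msingleE i (a : mcoord i) : (msingle a).1 i = a.
Proof. by rewrite ffunE dfwith_in. Qed.

Lemma msingle_out i (a : mcoord i) j : i != j -> (msingle a).1 j = 0%R.
Proof. by move=> neq_ij; rewrite ffunE dfwith_out. Qed.

Lemma msingle_inj i : injective (@msingle i).
Proof. by move=> a b E; rewrite -(msingleE a) E msingleE. Qed.

Lemma msingleD i (a b : mcoord i) : msingle (a + b)%R = (msingle a * msingle b)%g.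
Proof.
apply: msdP => [j|]; last by rewrite msdMg2 mulg1.
rewrite msdMg1 mact1_1; have [<-|neq_ij] := eqVneq i j; first by rewrite !msingleE.
by rewrite !msingle_out // addr0.
Qed.

Lemma msingle0 i : msingle (0%R : mcoord i) = 1%g.
Proof.
apply: msdP => // j; rewrite msd1E.
by have [<-|neq_ij] := eqVneq i j; rewrite ?msingleE ?msingle_out.
Qed.

Lemma msingleX i (a : mcoord i) n : (msingle a ^+ n)%g = msingle (a *+ n)%R.
Proof.
elim: n => [|n IHn]; first by rewrite mulr0n msingle0.
by rewrite expgS mulrS msingleD IHn.
Qed.

Lemma msdJ1 (x y : msdprod) i : x.2 = 1%g -> (x ^ y)%g.1 i = mact1 (x.1 i) y.2.
Proof.
move=> x2; rewrite conjgE !msdMg1 msdV1 /= x2 mul1g mact1N -mact1M mulVg mact1_1.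
by rewrite addrCA addNr addr0.
Qed.

Lemma msingleJ i (a : mcoord i) x : (msingle a ^ x)%g = msingle (mact1 a x.2).
Proof.
apply: msdP => [j|]; last by rewrite /= mul1g mulVg.
rewrite msdJ1 //=.
have [<-|neq_ij] := eqVneq i j; first by rewrite !msingleE.
by rewrite !msingle_out // mact10.
Qed.

Lemma msd_decomp (x : msdprod) : x.2 = 1%g -> (x = \prod_i msingle (x.1 i))%g.
Proof.
move=> x2; suff E (s : seq I) : uniq s -> (\prod_(i <- s) msingle (x.1 i))%g =
    ([ffun j => if j \in s then x.1 j else 0%R], 1%g) :> msdprod.
  rewrite E ?index_enum_uniq //; apply: msdP => // i.
  by rewrite ffunE mem_index_enum.
elim: s => [|i s IHs] /=; first by rewrite big_nil => _; apply: msdP => // j; rewrite msd1E ffunE.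
case/andP=> s'i /IHs Es; rewrite big_cons Es; apply: msdP => [j|]; last by rewrite msdMg2 mulg1.
rewrite msdMg1 mact1_1 !ffunE in_cons eq_sym.
have [<-|neq_ij] := eqVneq i j; first by rewrite dfwith_in (negPf s'i) addr0.
by rewrite dfwith_out // add0r.
Qed.

Lemma commute_msingle i j (a : mcoord i) (b : mcoord j) :
  commute (msingle a) (msingle b).
Proof.
by apply: msdP => // t; rewrite !msdMg1 !mact1_1 addrC.
Qed.

Lemma commute_minj_msingle k i (a : mcoord i) :
  mact1 a k = a -> commute (minj k) (msingle a).
Proof.
by move=> fix_a; apply/commute_sym/commgP/conjg_fixP; rewrite msingleJ fix_a.
Qed.

Lemma order_msingle i (a : mcoord i) : prime (mprime M i) -> a != 0%R ->
  #[msingle a] = mprime M i.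
Proof.
move=> p_pr nz_a; apply: nt_prime_order => //.
  rewrite msingleX -(msingle0 i); congr msingle.
  by apply/ffunP=> t; rewrite ffunMnE ffunE -mulr_natr pchar_Fp_0 // mulr0.
by apply: contra nz_a => /eqP E; rewrite -(inj_eq (@msingle_inj i)) E msingle0.
Qed.

(** The i-th module, as a subgroup of the semidirect product. *)
Definition mblock i : {set msdprod} := [set msingle a | a : mcoord i].

Fact mblock_group_set i : group_set (mblock i).
Proof.
apply/group_setP; split; first by apply/imsetP; exists 0%R; rewrite ?msingle0.
by move=> _ _ /imsetP[a _ ->] /imsetP[b _ ->]; rewrite -msingleD imset_f.
Qed.
Canonical mblock_group i := Group (mblock_group_set i).

Lemma mblock_normal i : mblock_group i <| [set: msdprod].
Proof.
apply/andP; split; first exact: subsetT.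
apply/subsetP=> x _; rewrite inE; apply/subsetP=> _ /imsetP[_ /imsetP[a _ ->] ->].
by rewrite msingleJ imset_f.
Qed.

Lemma mblock_abelian i : abelian (mblock_group i).
Proof.
by apply/centsP=> _ /imsetP[a _ ->] _ /imsetP[b _ ->]; apply: commute_msingle.
Qed.

Lemma card_mblock i : prime (mprime M i) -> #|mblock i| = (mprime M i ^ mdim M i)%N.
Proof.
move=> p_pr; rewrite card_imset ?card_ffun; last exact: msingle_inj.
by rewrite card_Fp // card_ord.
Qed.

Lemma card_msdprod : (forall i, prime (mprime M i)) ->
  #|[set: msdprod]| = (#|[set: K]| * \prod_i mprime M i ^ mdim M i)%N.
Proof.
move=> p_pr; rewrite !cardsT card_prod mulnC card_dep_ffun; congr (_ * _)%N.
rewrite foldrE big_map big_enum /=; apply: eq_bigr => i _.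
by rewrite card_ffun card_Fp // card_ord.
Qed.

Lemma msdprod_solvable : solvable [set: K] -> solvable [set: msdprod].
Proof.
move=> solK; pose N := 'ker mproj_morphism.
have nsN : N <| [set: msdprod] := ker_normal _.
rewrite (series_sol nsN); apply/andP; split.
  apply: abelian_sol; apply/centsP=> x Nx y Ny.
  have [x2 y2] : x.2 = 1%g /\ y.2 = 1%g by split; apply: (mker (f := mproj_morphism)).
  apply: msdP => [i|]; last by rewrite !msdMg2 x2 y2.
  by rewrite !msdMg1 x2 y2 !mact1_1 addrC.
rewrite (isog_sol (first_isog mproj_morphism)) (solvableS _ solK) //.
exact: subsetT.
Qed.
End MonomialSdprod.

(** * The group attached to a coloring *)

Definition is_red (c : color) := if c is Red then true else false.
Definition is_green (c : color) := if c is Green then true else false.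
Definition is_blue (c : color) := if c is Blue then true else false.

Lemma expr_Fp_add (R : comNzRingType) (g : nat) (theta : R) (x y : 'F_g) :
  prime g -> (theta ^+ g = 1)%R -> (theta ^+ (x + y)%R = theta ^+ x * theta ^+ y)%R.
Proof.
move=> g_pr theta1; rewrite -exprD -(expr_mod (x + y) theta1).
by rewrite /= [X in (_ %% X)]Fp_cast.
Qed.

Section LabelProducts.
Variables (F : finType) (R : pred F) (l : F -> nat).
Hypothesis l_prime : forall u, R u -> prime (l u).
Hypothesis l_inj : forall u v, R u -> R v -> l u = l v -> u = v.

Definition label_prod (A : pred F) : nat := \prod_(u | R u && A u) l u.

Lemma label_prod_gt0 A : 0 < label_prod A.
Proof. by apply: prodn_cond_gt0 => u /andP[/l_prime/prime_gt0]. Qed.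

Lemma label_prodS (A B : pred F) : (forall u, R u -> A u -> B u) -> label_prod A %| label_prod B.
Proof.
move=> sAB; rewrite /label_prod [X in _ %| X](bigID A) /=.
rewrite [X in _ %| X * _](eq_bigl (fun u => R u && A u)) ?dvdn_mulr // => u.
by rewrite -andbA; case Ru: (R u) => //=; apply: andb_idl; apply: sAB.
Qed.

Lemma label_prod_coprime u (A : pred F) : R u -> ~~ A u -> coprime (l u) (label_prod A).
Proof.
move=> Ru nAu; apply: (big_ind (coprime (l u))) => [|x y cx cy|v /andP[Rv Av]].
  exact: coprimen1.
  by rewrite coprimeMr cx.
rewrite prime_coprime ?l_prime // dvdn_prime2 ?l_prime //.
by apply: contra nAu => /eqP/(l_inj Ru Rv) ->.
Qed.

Lemma label_prod_dvd u (A : pred F) : R u -> A u -> l u %| label_prod A.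
Proof. by move=> Ru Au; rewrite /label_prod (bigD1 u) ?Ru //= dvdn_mulr. Qed.

Let m := label_prod predT.

(** The power m / l u of a generator of the cyclic group of order m has order l u;
    an m-th root of unity of order label_prod A is fixed by that power exactly when
    u is not in A. *)
Lemma label_prod_div u (A : pred F) : R u -> (label_prod A %| m %/ l u) = ~~ A u.
Proof.
move=> Ru; have lu := l_prime Ru; have lm : l u %| m by apply: label_prod_dvd.
have Em : m = (l u * label_prod (predC1 u))%N.
  rewrite /m /label_prod (bigD1 u) ?Ru //=; congr (_ * _)%N.
  by apply: eq_bigl => v; rewrite andbT.
rewrite Em mulKn ?prime_gt0 //; apply/idP/idP => [dv | nAu].
  apply/negP=> Au; have := dvdn_trans (label_prod_dvd Ru Au) dv.
  have := @label_prod_coprime u (predC1 u) Ru; rewrite /= eqxx => /(_ isT).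
  by rewrite prime_coprime // => /negP.
apply: label_prodS => v _ Av /=; apply: contraNneq nAu => <-.
by [].
Qed.
End LabelProducts.

Section Construction.
Variables (F : sgraph) (c : F -> color) (l g b : F -> nat).
Let E : rel F := @edge F.
Let R : pred F := fun u => is_red (c u).
Hypothesis l_prime : forall u, R u -> prime (l u).
Hypothesis l_inj : forall u v, R u -> R v -> l u = l v -> u = v.
Hypothesis g_prime : forall u, prime (g u).
Hypothesis b_prime : forall u, prime (b u).

Let lprod := label_prod R l.
Let m := lprod predT.
Hypothesis m_g : forall v, m %| (g v).-1.
Hypothesis m_b : forall w, m %| (b w).-1.
Hypothesis g_b : forall v w, g v %| (b w).-1.

Let m_gt0 : 0 < m. Proof. exact: label_prod_gt0. Qed.

(** The red groups adjacent to v act on the green module of v through omega, the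
    green group of v acts on the blue module of w through theta, and the red groups
    adjacent to w act on it through kappa. *)
Definition omega (v : F) : 'F_(g v) := Fp_prim_root (g v) (lprod (fun u => E u v)).
Definition theta (v w : F) : 'F_(b w) := Fp_prim_root (b w) (g v).
Definition kappa (w : F) : 'F_(b w) := Fp_prim_root (b w) (lprod (fun u => E u w)).

Lemma omega_prim v : ((lprod (fun u => E u v)).-primitive_root (omega v))%R.
Proof. by apply: Fp_prim_rootP => //; apply: dvdn_trans (m_g v); apply: label_prodS. Qed.

Lemma theta_prim v w : ((g v).-primitive_root (theta v w))%R.
Proof. exact: Fp_prim_rootP. Qed.

Lemma kappa_prim w : ((lprod (fun u => E u w)).-primitive_root (kappa w))%R.
Proof. by apply: Fp_prim_rootP => //; apply: dvdn_trans (m_b w); apply: label_prodS. Qed.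

Lemma omega_m v : (omega v ^+ m = 1)%R.
Proof. by apply/eqP; rewrite -(prim_order_dvd (omega_prim v)); apply: label_prodS. Qed.

Lemma kappa_m w : (kappa w ^+ m = 1)%R.
Proof. by apply/eqP; rewrite -(prim_order_dvd (kappa_prim w)); apply: label_prodS. Qed.

(** Cyclic of order m, the product of the red labels. *)
Definition red_group : finGroupType := 'I_m.-1.+1.

Lemma red_groupM (r s : red_group) : (r * s)%g = (r + s) %% m :> nat.
Proof. by congr (_ %% _); apply: prednK. Qed.

Fact green_scal1 v (t : 'I_(is_green (c v))) : (omega v ^+ (1%g : red_group) = 1)%R.
Proof. by []. Qed.

Fact green_scalM v (r s : red_group) (t : 'I_(is_green (c v))) :
  (omega v ^+ (r * s)%g = omega v ^+ s * omega v ^+ r)%R.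
Proof. by rewrite red_groupM (expr_mod _ (omega_m v)) exprD mulrC. Qed.

Definition green_family : monomial_family F red_group :=
  @MonomialFamily F red_group g (fun v => is_green (c v))
    (fun v _ t => t) (fun v r _ => omega v ^+ r)%R
    (fun _ _ => erefl) (fun _ _ _ _ => erefl) green_scal1 green_scalM.

Definition green_group : finGroupType := msdprod green_family.

(** The module of v has one index if v is green and none otherwise, so this sum is
    the value at that index, or 0. *)
Definition green_coord (v : F) (h : green_group) : 'F_(g v) :=
  (\sum_t (h.1 v : {ffun 'I_(is_green (c v)) -> 'F_(g v)}) t)%R.

Lemma green_coordM v (h h' : green_group) :
  green_coord v (h * h')%g =
  (omega v ^+ (h'.2 : red_group) * green_coord v h + green_coord v h')%R.
Proof.
rewrite /green_coord msdMg1 -[RHS]/(_ + _)%R mulr_sumr -big_split /=.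
by apply: eq_bigr => t _; rewrite !ffunE.
Qed.

Definition two_pathb (u w : F) : bool := [exists v, Defs.arc c u v && Defs.arc c v w].

(** The red groups with a 2-path to w permute the coordinates of the module of w
    cyclically. *)
Definition blue_dim (w : F) : nat :=
  if is_blue (c w) then lprod (fun u => two_pathb u w) else 0.

Lemma blue_dim_dvd w (t : 'I_(blue_dim w)) : blue_dim w %| m.
Proof.
case: t => t; rewrite /blue_dim; case: ifP => // _ _.
by apply: label_prodS.
Qed.

(** A red vertex with an arc to v has a 2-path to w, so the order of omega v
    divides blue_dim w. *)
Lemma omega_mod v w (t : 'I_(blue_dim w)) k : is_green (c v) -> edge v w ->
  (omega v ^+ (k %% blue_dim w) = omega v ^+ k)%R.
Proof.
move=> gv vw; apply: expr_mod; apply/eqP.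
rewrite -(prim_order_dvd (omega_prim v)).
case: t => t; rewrite /blue_dim; case: ifP => // bw _.
apply: label_prodS => u Ru uv; apply/existsP; exists v; rewrite /Defs.arc vw.
move: uv Ru gv bw; rewrite /E /R => ->.
by case: (c u); case: (c v); case: (c w).
Qed.

(** The green group of v acts on the t-th coordinate through theta v w, twisted by
    the action of the red generator iterated t times: the module is induced. *)
Definition blue_char (w : F) (h : green_group) (t : nat) : 'F_(b w) :=
  (\prod_(v | is_green (c v) && edge v w)
     theta v w ^+ (omega v ^+ t * green_coord v h)%R)%R.

Definition blue_scal (w : F) (h : green_group) (t : 'I_(blue_dim w)) : 'F_(b w) :=
  (blue_char w h t * kappa w ^+ (h.2 : red_group))%R.

Definition blue_shift (w : F) (h : green_group) (t : 'I_(blue_dim w)) :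
    'I_(blue_dim w) :=
  Ordinal (ltn_pmod (t + (h.2 : red_group)) (leq_ltn_trans (leq0n t) (ltn_ord t))).

Lemma theta_g v w : (theta v w ^+ g v = 1)%R.
Proof. exact: prim_expr_order (theta_prim v w). Qed.

Fact blue_shift1 w (t : 'I_(blue_dim w)) : blue_shift (1%g : green_group) t = t.
Proof. by apply: val_inj; rewrite /= addn0 modn_small. Qed.

Fact blue_shiftM w (h h' : green_group) (t : 'I_(blue_dim w)) :
  blue_shift (h * h')%g t = blue_shift h (blue_shift h' t).
Proof.
apply: val_inj => /=.
rewrite -[X in t + X]/(nat_of_ord (h.2 * h'.2 : red_group)%g) red_groupM modnDml -addnA.
rewrite -modnDmr modn_dvdm ?(blue_dim_dvd t) // modnDmr.
by rewrite [(h.2 + h'.2)%N]addnC.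
Qed.

Fact blue_scal1 w (t : 'I_(blue_dim w)) : blue_scal (1%g : green_group) t = 1%R.
Proof.
rewrite /blue_scal expr0 mulr1; apply: big1 => v _.
rewrite /green_coord big1 ?mulr0 ?expr0 // => s _.
by rewrite msd1E ffunE.
Qed.

Lemma blue_charM w (h h' : green_group) (t : 'I_(blue_dim w)) :
  blue_char w (h * h')%g t = (blue_char w h' t * blue_char w h (blue_shift h' t))%R.
Proof.
rewrite -big_split /=; apply: eq_bigr => v /andP[gv vw].
rewrite green_coordM mulrDr expr_Fp_add ?theta_g // mulrC; congr (_ * theta v w ^+ _)%R.
by rewrite (omega_mod t) // exprD mulrA.
Qed.

Fact blue_scalM w (h h' : green_group) (t : 'I_(blue_dim w)) :
  blue_scal (h * h')%g t = (blue_scal h' t * blue_scal h (blue_shift h' t))%R.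
Proof.
rewrite /blue_scal blue_charM red_groupM (expr_mod _ (kappa_m w)) exprD.
by rewrite [RHS]mulrACA; congr (_ * _)%R; apply: mulrC.
Qed.

Definition blue_family : monomial_family F green_group :=
  MonomialFamily (mprime := b) blue_shift1 blue_shiftM blue_scal1 blue_scalM.

Definition graph_group : finGroupType := msdprod blue_family.

Hypothesis g_inj : injective g.
Hypothesis b_inj : injective b.
Hypothesis l_neq_g : forall u v, R u -> l u != g v.
Hypothesis l_neq_b : forall u v, R u -> l u != b v.
Hypothesis g_neq_b : forall u v, g u != b v.
Hypothesis F_triangle_free : triangle_free F.
Hypothesis c_proper : proper_coloring c.

Definition vprime (u : F) : nat :=
  match c u with Red => l u | Green => g u | Blue => b u end.

Definition vdim (u : F) : nat := if c u is Blue then blue_dim u else 1.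

Lemma vprime_prime u : prime (vprime u).
Proof. by rewrite /vprime; case cu: (c u) => //; apply: l_prime; rewrite /R cu. Qed.

Lemma vprime_inj : injective vprime.
Proof.
move=> u v; rewrite /vprime.
have Rx x : c x = Red -> R x by rewrite /R => ->.
case cu: (c u); case cv: (c v) => // eq_uv.
- exact: l_inj (Rx _ cu) (Rx _ cv) eq_uv.
- by have := l_neq_g v (Rx _ cu); rewrite eq_uv eqxx.
- by have := l_neq_b v (Rx _ cu); rewrite eq_uv eqxx.
- by have := l_neq_g u (Rx _ cv); rewrite eq_uv eqxx.
- exact: g_inj.
- by have := g_neq_b u v; rewrite eq_uv eqxx.
- by have := l_neq_b u (Rx _ cv); rewrite eq_uv eqxx.
- by have := g_neq_b v u; rewrite eq_uv eqxx.
exact: b_inj.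
Qed.

Local Notation GG := [set: graph_group]%G.

Lemma card_graph_group : #|GG| = \prod_u vprime u ^ vdim u.
Proof.
rewrite (card_msdprod (M := blue_family)) // (card_msdprod (M := green_family)) //.
rewrite cardsT card_ord prednK // /m /lprod /label_prod big_mkcond -!big_split /=.
apply: eq_bigr => u _; rewrite /vprime /vdim /R /= andbT.
case cu: (c u) => /=.
- by rewrite /blue_dim cu expn0 !muln1.
- by rewrite /blue_dim cu expn0 mul1n muln1.
by rewrite expn0 !mul1n.
Qed.

Lemma vprime_coprime u v k : u != v -> coprime (vprime u) (vprime v ^ k).
Proof.
move=> neq_uv; rewrite coprimeXr // prime_coprime ?vprime_prime //.
by rewrite dvdn_prime2 ?vprime_prime // (inj_eq vprime_inj).
Qed.

Lemma logn_graph_group u : logn (vprime u) #|GG| = vdim u.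
Proof.
have pu := vprime_prime u; rewrite card_graph_group (bigD1 u) //=.
rewrite lognM ?expn_gt0 ?(prime_gt0 pu) //; last first.
  by apply: prodn_cond_gt0 => v _; rewrite expn_gt0 prime_gt0 ?vprime_prime.
rewrite lognX logn_prime // eqxx muln1 logn_coprime ?addn0 //.
apply: (big_ind (coprime (vprime u))) => [|x y cx cy|v neq_vu]; first exact: coprimen1.
  by rewrite coprimeMr cx.
by rewrite vprime_coprime // eq_sym.
Qed.

Lemma vprime_dvd_card p : prime p -> p %| #|GG| -> exists u, p = vprime u.
Proof.
move=> p_pr; rewrite card_graph_group Euclid_dvd_prod // big_has => /hasP[u _].
rewrite Euclid_dvdX // => /andP[pu _]; exists u.
by apply/eqP; rewrite -dvdn_prime2 ?vprime_prime.
Qed.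

Lemma graph_group_solvable : solvable GG.
Proof.
apply: (@msdprod_solvable _ _ blue_family).
apply: (@msdprod_solvable _ _ green_family).
by apply: abelian_sol; apply: Zp_abelian.
Qed.

Lemma graph_group_power_free n :
  1 < n -> (forall w, blue_dim w < n) -> power_free n #|GG|.
Proof.
move=> n_gt1 dim_lt; split=> [|p p_pr]; first exact: cardG_gt0.
apply/negP=> pn; have p_dvd : p %| #|GG|.
  by apply: dvdn_trans pn; rewrite dvdn_exp // ltnW.
have [u Dp] := vprime_dvd_card p_pr p_dvd.
move: pn; rewrite pfactor_dvdn // Dp logn_graph_group leqNgt => /negP; apply.
by rewrite /vdim; case: (c u).
Qed.

Definition red_gen (u : F) : red_group := inZp (m %/ l u).
Definition green_one (v : F) : {ffun 'I_(mdim green_family v) -> 'F_(mprime green_family v)} :=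
  [ffun _ => 1%R].
Definition green_gen (v : F) : green_group := msingle (green_one v).
Definition blue_one (w : F) : {ffun 'I_(mdim blue_family w) -> 'F_(mprime blue_family w)} :=
  [ffun _ => 1%R].

(** An element of order vprime u. For a blue vertex it is the constant function 1,
    which is fixed by the cyclic shifts. *)
Definition vertex_gen (u : F) : graph_group :=
  match c u with
  | Red => minj blue_family (minj green_family (red_gen u))
  | Green => minj blue_family (green_gen u)
  | Blue => msingle (blue_one u)
  end.

Lemma red_genE u : R u -> red_gen u = m %/ l u :> nat.
Proof.
move=> Ru; rewrite /= prednK // modn_small // ltn_Pdiv //.
exact/prime_gt1/l_prime.
Qed.

Lemma red_gen_order u : R u -> #[red_gen u] = l u.
Proof.
move=> Ru; have l_pr := l_prime Ru.
have lm : l u %| m by apply: label_prod_dvd.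
apply: nt_prime_order => //.
  apply: val_inj; rewrite Zp_expg /= !prednK // modnMml divnK // modnn.
  by [].
apply/eqP => /(congr1 val); rewrite /= prednK // modn_small ?ltn_Pdiv ?prime_gt1 //.
by apply/eqP; rewrite -lt0n divn_gt0 ?prime_gt0 // dvdn_leq.
Qed.

Lemma green_one_neq0 v : c v = Green -> green_one v != 0%R.
Proof.
move=> gv; have t : 'I_(mdim green_family v) by rewrite /= gv; exact: ord0.
by apply/eqP=> /ffunP/(_ t)/eqP; rewrite !ffunE oner_eq0.
Qed.

Lemma blue_one_neq0 w : c w = Blue -> blue_one w != 0%R.
Proof.
move=> bw; have t : 'I_(mdim blue_family w).
  have d_gt0 : 0 < mdim blue_family w by rewrite /= /blue_dim bw label_prod_gt0.
  exact: Ordinal d_gt0.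
by apply/eqP=> /ffunP/(_ t)/eqP; rewrite !ffunE oner_eq0.
Qed.

Lemma vertex_gen_order u : #[vertex_gen u] = vprime u.
Proof.
rewrite /vertex_gen /vprime; case cu: (c u).
- by rewrite !order_minj red_gen_order // /R cu.
- by rewrite order_minj order_msingle //; apply: green_one_neq0.
by rewrite order_msingle //; apply: blue_one_neq0.
Qed.

Lemma omega_red_gen u v : R u -> ((omega v ^+ red_gen u)%R == 1%R) = ~~ edge u v.
Proof.
move=> Ru; rewrite red_genE // -(prim_order_dvd (omega_prim v)).
by rewrite /lprod /m label_prod_div.
Qed.

Lemma kappa_red_gen u w : R u -> ((kappa w ^+ red_gen u)%R == 1%R) = ~~ edge u w.
Proof.
move=> Ru; rewrite red_genE // -(prim_order_dvd (kappa_prim w)).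
by rewrite /lprod /m label_prod_div.
Qed.

Lemma green_coord_minj v r : green_coord v (minj green_family r : green_group) = 0%R.
Proof. by apply: big1 => t _; rewrite !ffunE. Qed.

Lemma green_coord_gen v v' : c v = Green ->
  green_coord v (green_gen v') = (v' == v)%:R%R.
Proof.
move=> gv; have [-> | neq_vv'] := eqVneq v' v; last first.
  by apply: big1 => t _; rewrite msingle_out // ffunE.
rewrite /green_coord (eq_bigr (fun _ => 1%R)) => [|t _]; last by rewrite msingleE ffunE.
by rewrite sumr_const card_ord /= gv.
Qed.

Lemma red_gen_commute_green u v : R u -> ~~ edge u v ->
  commute (minj green_family (red_gen u)) (green_gen v).
Proof.
move=> Ru nuv; apply: commute_minj_msingle; apply/ffunP=> t; rewrite !ffunE mulr1.
by apply/eqP; rewrite /= (omega_red_gen v Ru).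
Qed.

Lemma blue_char_minj w r t : blue_char w (minj green_family r : green_group) t = 1%R.
Proof. by apply: big1 => v _; rewrite green_coord_minj mulr0 expr0. Qed.

Lemma blue_char_gen v w t : c v = Green ->
  (blue_char w (green_gen v) t = if edge v w then theta v w ^+ (omega v ^+ t)%R else 1)%R.
Proof.
move=> gv; have triv v' : is_green (c v') -> v' != v ->
    (theta v' w ^+ (omega v' ^+ t * green_coord v' (green_gen v))%R = 1)%R.
  move=> gv' neq; rewrite green_coord_gen; last by case: (c v') gv'.
  by rewrite eq_sym (negPf neq) mulr0 expr0.
rewrite /blue_char; case: ifP => vw; last first.
  apply: big1 => v' /andP[gv' v'w]; apply: triv => //.
  by apply: contraFneq vw => <-.
rewrite (bigD1 v); last by rewrite gv vw.
rewrite big1 => [|v' /andP[/andP[gv' _] neq]]; last exact: triv.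
by rewrite green_coord_gen // eqxx mulr1n mulr1 [LHS]mulr1.
Qed.

(** Each pair of colors reduces to the triviality of the root of unity through which
    one generator acts on the module of the other. *)
Lemma vertex_gen_commute u v : u != v -> ~~ edge u v -> commute (vertex_gen u) (vertex_gen v).
Proof.
have Rx x : c x = Red -> R x by rewrite /R => ->.
have minjC h h' : commute h h' -> commute (minj blue_family h) (minj blue_family h').
  by rewrite /commute -!minjM => ->.
have RG x y : c x = Red -> c y = Green -> ~~ edge x y -> commute (vertex_gen x) (vertex_gen y).
  move=> cx cy nxy; rewrite /vertex_gen cx cy; apply: minjC.
  exact: red_gen_commute_green (Rx _ cx) nxy.
have RB x y : c x = Red -> c y = Blue -> ~~ edge x y -> commute (vertex_gen x) (vertex_gen y).
  move=> cx cy nxy; rewrite /vertex_gen cx cy; apply: commute_minj_msingle.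
  apply/ffunP=> t; rewrite !ffunE mulr1 /= /blue_scal blue_char_minj mul1r.
  by apply/eqP; rewrite /= (kappa_red_gen y (Rx _ cx)).
have GB x y : c x = Green -> c y = Blue -> ~~ edge x y -> commute (vertex_gen x) (vertex_gen y).
  move=> cx cy nxy; rewrite /vertex_gen cx cy; apply: commute_minj_msingle.
  apply/ffunP=> t; rewrite !ffunE mulr1 /= /blue_scal blue_char_gen //.
  by rewrite (negPf nxy) mul1r expr0.
move=> neq nuv; have nvu : ~~ edge v u by rewrite edge_sym.
case cu: (c u); case cv: (c v); try by [exact: RG | exact: RB | exact: GB].
- rewrite /vertex_gen cu cv; apply: minjC; rewrite /commute -!minjM.
  by congr minj; apply: (centsP (Zp_abelian _)); rewrite inE.
- by apply: commute_sym; apply: RG.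
- by rewrite /vertex_gen cu cv; apply: minjC; apply: commute_msingle.
- by apply: commute_sym; apply: RB.
- by apply: commute_sym; apply: GB.
by rewrite /vertex_gen cu cv; apply: commute_msingle.
Qed.

Lemma codegree_of_nonedge u v : u != v -> ~~ edge u v ->
  exists i : Iirr GG, vprime u * vprime v %| codegree i.
Proof.
move=> neq_uv nuv; have [pu pv] := (vprime_prime u, vprime_prime v).
have neq_p : vprime u != vprime v by rewrite (inj_eq vprime_inj).
have /exists_inP[x Gx /eqP ox] : gk_edge GG (vprime u) (vprime v).
  apply: (gk_edge_commute pu pv neq_p _ _ (vertex_gen_commute neq_uv nuv)); rewrite ?inE //.
    by rewrite vertex_gen_order.
  by rewrite vertex_gen_order.
exact: exists_codegree_order_mul graph_group_solvable Gx pu pv neq_p ox.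
Qed.

Lemma mblock_Sylow w : c w = Blue -> (vprime w).-Sylow(GG) (mblock_group blue_family w).
Proof.
move=> bw; rewrite pHallE subsetT /= card_mblock // p_part logn_graph_group.
by rewrite /vprime /vdim bw.
Qed.

Lemma vertex_gen_Sylow u : c u <> Blue -> (vprime u).-Sylow(GG) <[vertex_gen u]>%G.
Proof.
move=> nb; rewrite pHallE subsetT /= -orderE vertex_gen_order p_part logn_graph_group.
by rewrite /vdim; case: (c u) nb => //; rewrite expn1.
Qed.

Lemma vprime_sqr_ndvd u : c u <> Blue -> ~~ (vprime u ^ 2 %| #|GG|).
Proof.
move=> nb; rewrite pfactor_dvdn ?vprime_prime // logn_graph_group -ltnNge /vdim.
by case: (c u) nb.
Qed.

Lemma cent_mblock w (h : green_group) :
  (forall t : 'I_(blue_dim w), blue_shift h t = t) ->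
  (forall t : 'I_(blue_dim w), blue_scal h t != 1%R) ->
  ('C_(mblock_group blue_family w)[minj blue_family h] = 1)%g.
Proof.
move=> shift1 scal1; apply/trivgP/subsetP=> _ /setIP[/imsetP[a _ ->] /cent1P cah].
have /conjg_fixP := introT commgP cah; rewrite msingleJ /= => /msingle_inj fix_a.
rewrite inE -(msingle0 blue_family w); apply/eqP; congr msingle; apply/ffunP=> t.
move/ffunP/(_ t): fix_a; rewrite !ffunE /= shift1 => /eqP.
rewrite -subr_eq0 -[X in (_ - X)%R]mul1r -mulrBl mulf_eq0 subr_eq0 (negPf (scal1 t)).
by move/eqP.
Qed.

(** A red generator adjacent to w has no 2-path to w, because there are no triangles:
    it does not shift the coordinates, and multiplies them by a nontrivial root of
    unity. A green one multiplies the coordinates by nontrivial roots of unity. *)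
Lemma cent_mblock_gen v w : c v <> Blue -> c w = Blue -> edge v w ->
  ('C_(mblock_group blue_family w)[vertex_gen v] = 1)%g.
Proof.
move=> nb bw vw; rewrite /vertex_gen; case cv: (c v) nb => // _.
  have Rv : R v by rewrite /R cv.
  apply: cent_mblock => t.
    apply: val_inj; rewrite /= prednK // (modn_small (m := m %/ l v)); last first.
      by rewrite ltn_Pdiv // prime_gt1 // l_prime.
    have /dvdnP[k ->] : blue_dim w %| m %/ l v.
      rewrite /blue_dim bw /= label_prod_div //; apply/existsP=> -[y /andP[vy yw]].
      case/andP: vy => vy _; case/andP: yw => yw _.
      by apply: (F_triangle_free (u := v) (v := y) (w := w)).
    by rewrite addnC modnMDl modn_small.
  rewrite /blue_scal blue_char_minj mul1r.
  by rewrite /= (kappa_red_gen w Rv) negbK.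
apply: cent_mblock => t; first by apply: val_inj; rewrite /= addn0 modn_small.
rewrite /blue_scal blue_char_gen // vw expr0 mulr1.
rewrite -(prim_order_dvd (theta_prim v w)); apply/negP=> dv.
have : (omega v ^+ t)%R == 0%R.
  rewrite -val_eqE /=; move: dv; rewrite /dvdn modn_small //.
  by have := ltn_ord (omega v ^+ t)%R; rewrite [X in _ < X]Fp_cast.
rewrite expf_eq0 => /andP[_ /eqP w0].
have := prim_expr_order (omega_prim v).
by rewrite w0 expr0n gtn_eqF ?label_prod_gt0.
Qed.

Lemma blue_codegree v w (i : Iirr GG) : c v <> Blue -> c w = Blue -> edge v w ->
  ~~ (mblock_group blue_family w \subset cfker 'chi_i) -> ~~ (vprime v %| codegree i).
Proof.
move=> nb bw vw; apply: not_dvd_codegree_regular (cent_mblock_gen nb bw vw).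
- exact: vprime_prime.
- exact: mblock_normal.
- exact: mblock_abelian.
- by rewrite inE.
- exact: vertex_gen_order.
exact: vprime_sqr_ndvd.
Qed.

Lemma green_genJ v (h : green_group) : c v = Green ->
  (vertex_gen v ^ minj blue_family h)%g = (vertex_gen v ^+ (omega v ^+ (h.2 : red_group))%R)%g.
Proof.
move=> cv; rewrite /vertex_gen cv.
have -> : (minj blue_family (green_gen v) ^ minj blue_family h
           = minj blue_family (green_gen v ^ h))%g.
  by rewrite !conjgE !minjM (morphV (minj_morphism blue_family)) ?inE.
have Xk k : (minj blue_family (green_gen v) ^+ k = minj blue_family (green_gen v ^+ k))%g.
  by rewrite (morphX (minj_morphism blue_family)) ?inE.
rewrite Xk; congr minj; rewrite msingleJ msingleX; congr msingle.
by apply/ffunP=> t; rewrite ffunMnE !ffunE mulr1 /= natr_Zp.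
Qed.

Lemma green_gen_trivial v w k (a : {ffun 'I_(mdim blue_family w) -> 'F_(mprime blue_family w)}) :
  c v = Green -> ~~ (is_blue (c w) && edge v w) -> mact1 a (green_gen v ^+ k)%g = a.
Proof.
move=> cv nvw; elim: k => [|k IHk]; first exact: mact1_1.
rewrite expgS mact1M -[RHS]IHk; congr mact1; apply/ffunP=> t; rewrite ffunE /=.
have bw : is_blue (c w).
  by case: t => t /=; rewrite /blue_dim; case: (is_blue (c w)).
rewrite bw /= in nvw; rewrite /blue_scal blue_char_gen // (negPf nvw) expr0 !mul1r.
by congr (a _); apply: val_inj; rewrite /= addn0 modn_small.
Qed.

(** The green generator of v commutes with the blocks of the blue vertices that are
    not adjacent to v, and the red and green parts map it to its powers. *)
Lemma green_gen_conj v (K : {group graph_group}) x : c v = Green ->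
  (forall w, is_blue (c w) && edge v w -> mblock_group blue_family w \subset K) ->
  exists2 y, y \in K &
    (vertex_gen v ^ x = vertex_gen v ^+ (omega v ^+ (x.2.2 : red_group))%R * y)%g.
Proof.
move=> cv sBK; set k := nat_of_ord _.
pose beta : graph_group := (x.1, 1%g).
have Dx : (x = minj blue_family x.2 * beta)%g.
  by apply: msdP => [w|]; rewrite ?msdMg1 ?msdMg2 ?mulg1 //= ffunE mact10 add0r.
exists [~ vertex_gen v ^+ k, beta]%g; last first.
  by rewrite {1}Dx conjgM green_genJ // -/k -conjg_mulR.
set y := [~ _, _]%g.
have y2 : y.2 = 1%g by apply: (commg1 (vertex_gen v ^+ k)%g.2).
rewrite (msd_decomp y2); apply: group_prod => w _.
have [/sBK sB | nvw] := boolP (is_blue (c w) && edge v w).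
  by apply: (subsetP sB); apply: imset_f.
suff -> : y.1 w = 0%R by rewrite msingle0 group1.
have gk2 : (vertex_gen v ^+ k)%g.2 = (green_gen v ^+ k)%g.
  by rewrite /vertex_gen cv -(morphX (minj_morphism blue_family)) ?inE.
rewrite /y commgEr msdMg1 mact1_1 msdJ1 ?gk2 /= ?invg1 // green_gen_trivial //.
by rewrite ffunE mact1_1 addNr.
Qed.

(** Let g v divide the codegree. By blue_codegree the blocks of all blue neighbors of
    v lie in the kernel, so that the green generator of v generates a normal subgroup
    of G / ker by green_gen_conj. The red generator of u acts freely on it, and
    not_dvd_codegree_regular excludes l u from the codegree. *)
Lemma red_green_codegree u v (i : Iirr GG) :
  c u = Red -> c v = Green -> edge u v -> vprime v %| codegree i ->
  ~~ (vprime u %| codegree i).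
Proof.
move=> cu cv uv pv; apply/negP=> pu.
pose K := cfker_group 'chi_i.
have nsKG : K <| GG := cfker_normal 'chi_i.
have nKG x : x \in 'N(K) by apply: (subsetP (normal_norm nsKG)); rewrite inE.
have nbu : c u <> Blue by rewrite cu.
have nbv : c v <> Blue by rewrite cv.
have eK : ~~ (<[vertex_gen v]> \subset K) :=
    Sylow_not_sub_cfker (vprime_prime v) (vertex_gen_Sylow nbv) pv.
have fK : ~~ (<[vertex_gen u]> \subset K) :=
    Sylow_not_sub_cfker (vprime_prime u) (vertex_gen_Sylow nbu) pu.
have TI x : ~~ (<[vertex_gen x]> \subset K) -> K :&: <[vertex_gen x]> = 1%g.
  by move=> nK; rewrite setIC prime_TIg // -orderE vertex_gen_order vprime_prime.
have oe := order_quotient_TI (nKG _) (TI v eK).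
have of_ := order_quotient_TI (nKG _) (TI u fK).
have sBK w : is_blue (c w) && edge v w -> mblock_group blue_family w \subset K.
  case/andP=> bw vw; apply: contraLR pv; apply: blue_codegree => //.
  by case: (c w) bw.
have [j Dj ffj] := codegree_quo_faithful i.
have Rv : R u by rewrite /R cu.
pose N := <[coset K (vertex_gen v)]>%G.
have nsN : N <| (GG / K)%G.
  rewrite /normal cycle_subG mem_quotient ?inE //=.
  apply/subsetP=> _ /morphimP[x _ _ ->]; rewrite inE -cycleJ cycle_subG.
  have [y Ky ->]: exists2 y, y \in K & (coset K (vertex_gen v) ^ coset K x
      = coset K (vertex_gen v) ^+ (omega v ^+ (x.2.2 : red_group))%R * coset K y)%g.
    have [y Ky Ex] := green_gen_conj x cv sBK; exists y => //.
    by rewrite -morphJ ?nKG // Ex morphM ?nKG // morphX ?nKG.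
  by rewrite [coset K y]coset_id // mulg1 mem_cycle.
have centN : ('C_N[coset K (vertex_gen u)] = 1)%g.
  rewrite prime_TIg //; first by rewrite -orderE oe vertex_gen_order vprime_prime.
  rewrite cycle_subG; apply/negP=> /cent1P/commgP/conjg_fixP.
  rewrite -morphJ ?nKG // {2}/vertex_gen cu green_genJ // => /eqP.
  rewrite -(inj_eq (mulIg (coset K (vertex_gen v))^-1%g)) mulgV -morphV ?nKG // -morphM ?nKG //.
  move/eqP/coset_idr; rewrite nKG => /(_ isT) eK'.
  have : (vertex_gen v ^+ (omega v ^+ red_gen u)%R * (vertex_gen v)^-1
    \in K :&: <[vertex_gen v]>)%g.
    by rewrite inE eK' groupM ?mem_cycle // groupV cycle_id.
  rewrite (TI v eK) inE -eq_mulgV1 -{2}[vertex_gen v]expg1 eq_expg_mod_order vertex_gen_order.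
  rewrite /vprime cv !modn_small ?prime_gt1 // => [|]; last first.
    by have := ltn_ord (omega v ^+ red_gen u)%R; rewrite [X in _ < X]Fp_cast.
  have := omega_red_gen v Rv; rewrite uv /= => /eqP nE /eqP Ek; apply: nE.
  by apply: val_inj; rewrite /= Ek /= modn_small // Fp_cast ?prime_gt1.
have p2 : ~~ (vprime u ^ 2 %| #|(GG / K)%G|).
  apply: contra (vprime_sqr_ndvd nbu) => dv.
  exact: dvdn_trans dv (dvdn_quotient _ _).
have nNj : ~~ (N \subset cfker 'chi_j).
  apply/negP=> /subset_trans/(_ ffj); rewrite subG1 trivg_card1 -orderE oe vertex_gen_order.
  by rewrite gtn_eqF ?prime_gt1 ?vprime_prime.
have of2 : #[coset K (vertex_gen u)] = vprime u by rewrite of_ vertex_gen_order.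
have := not_dvd_codegree_regular (vprime_prime u) nsN (cycle_abelian _)
  (mem_quotient K (in_setT (vertex_gen u))) of2 p2 centN nNj.
by rewrite -Dj pu.
Qed.

(** Between a blue vertex and a neighbor this is blue_codegree: a codegree divisible
    by b w belongs to a character that is nontrivial on the Sylow subgroup of w. *)
Lemma codegree_edge u v (i : Iirr GG) :
  edge u v -> ~~ (vprime u * vprime v %| codegree i).
Proof.
have dl x y k : x * y %| k -> x %| k by apply: dvdn_trans; apply: dvdn_mulr.
have dr x y k : x * y %| k -> y %| k by apply: dvdn_trans; apply: dvdn_mull.
wlog sym : u v / (c u = Red) \/ (c u = Green /\ c v = Blue).
  move=> IH uv; have neq := c_proper uv.
  case cu: (c u) neq; case cv: (c v) => // _; try by apply: IH uv; auto.
  - by rewrite mulnC; apply: IH; [left | rewrite edge_sym].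
  - by rewrite mulnC; apply: IH; [left | rewrite edge_sym].
  by rewrite mulnC; apply: IH; [right | rewrite edge_sym].
move=> uv; have neq := c_proper uv; apply/negP=> dv.
have [pu pv] := (dl _ _ _ dv, dr _ _ _ dv).
have blue : c u <> Blue -> c v = Blue -> False.
  move=> nb bv; have := Sylow_not_sub_cfker (vprime_prime v) (mblock_Sylow bv) pv.
  by move/(blue_codegree nb bv uv); rewrite pu.
case: sym => [cu | [cu cv]]; last by apply: blue => //; rewrite cu.
case cv: (c v); first by rewrite cu cv in neq.
  by have := red_green_codegree cu cv uv pv; rewrite pu.
by apply: blue => //; rewrite cu.
Qed.

Lemma exists_graph_group n : 1 < n -> (forall w, blue_dim w < n) ->
  exists (gT : finGroupType) (G : {group gT}) (P : F -> nat),
    [/\ solvable G, power_free n #|G|, injective P,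
        forall p, p \in primes #|G| <-> exists u, p = P u
      & forall u v, u != v ->
          ((exists i : Iirr G, P u * P v %| codegree i) <-> ~~ edge u v)].
Proof.
move=> n_gt1 dim_lt; exists graph_group, GG, vprime; split.
- exact: graph_group_solvable.
- exact: graph_group_power_free.
- exact: vprime_inj.
- move=> p; rewrite mem_primes cardG_gt0 /=.
  split=> [/andP[p_pr pG] | [u ->]]; first exact: vprime_dvd_card pG.
  by rewrite vprime_prime -vertex_gen_order order_dvdG ?inE.
move=> u v neq_uv; split=> [[i dvi]|]; last exact: codegree_of_nonedge.
by apply/negP=> uv; have := codegree_edge i uv; rewrite dvi.
Qed.
End Construction.

(** * The equivalence *)

Lemma vertex_cod_primes (gT : finGroupType) (G : {group gT}) p :
  solvable G -> (p \in cod_primes G) = (p \in primes #|G|).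
Proof.
move=> solG; rewrite mem_primes cardG_gt0 /=.
apply/mem_cod_primes/andP=> [[p_pr [_ /mapP[i _ ->] pi]] | [p_pr pG]].
  by split=> //; apply: dvdn_trans pi (codegree_dvd_card i).
split=> //; have [i pi] := exists_codegree_pdiv solG p_pr pG.
by exists (codegree i) => //; apply/mapP; exists i; rewrite ?mem_enum.
Qed.

Lemma cod_graph_iso_of_primes (F : sgraph) (gT : finGroupType) (G : {group gT})
    (P : F -> nat) :
  solvable G -> injective P ->
  (forall p, p \in primes #|G| <-> exists u, p = P u) ->
  (forall u v, u != v ->
     ((exists i : Iirr G, P u * P v %| codegree i) <-> edge u v)) ->
  graph_iso F (cod_graph G).
Proof.
move=> solG injP primesG edgeP.
have P_cod u : P u \in cod_primes G.
  by rewrite vertex_cod_primes //; apply/primesG; exists u.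
pose f u : cod_graph G := SeqSub (P_cod u).
have inj_f : injective f by move=> u v /(congr1 val) /injP.
exists f; last first.
  move=> u v; have [<-|neq_uv] := eqVneq u v; first by rewrite !edge_irr.
  rewrite [LHS]/(_ && _) (inj_eq inj_f) neq_uv /=.
  apply/hasP/idP=> [[_ /mapP[i _ ->] dvi] | uv]; first by apply/edgeP => //; exists i.
  have [i dvi] := (edgeP u v neq_uv).2 uv.
  by exists (codegree i) => //; apply/mapP; exists i; rewrite ?mem_enum.
apply: (inj_card_bij inj_f).
rewrite -(card_codom inj_f); apply/subset_leq_card/subsetP=> x _.
have := valP x; rewrite vertex_cod_primes // => /primesG[u Dx].
by apply/codomP; exists u; apply: val_inj.
Qed.

Section Backward.
Variables (n : nat) (X : sgraph) (c : X -> color) (l : X -> nat).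
Hypotheses (n_gt1 : 1 < n) (tfX : triangle_free X) (properX : proper_coloring c).
Hypotheses (labX : red_labeling c l) (boundX : bounded_two_paths c n l).

Let R : pred X := fun u => is_red (c u).
Let redE u : R u -> c u = Red. Proof. by rewrite /R; case: (c u). Qed.
Let l_prime u : R u -> prime (l u). Proof. by move/redE; apply: labX.1. Qed.
Let l_inj u v : R u -> R v -> l u = l v -> u = v.
Proof. by move=> /redE cu /redE cv; apply: labX.2. Qed.

(** The red labels with a 2-path to w violate the bound if their product is at
    least n. *)
Lemma blue_dim_lt w : blue_dim c l w < n.
Proof.
rewrite /blue_dim; case bw: (is_blue (c w)); last exact: ltnW.
rewrite ltnNge; apply/negP=> le_n.
pose pi := [seq l u | u <- index_enum X & R u && two_pathb c u w].
have mem_pi u : R u -> (l u \in pi) = two_pathb c u w.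
  move=> Ru; apply/mapP/idP=> [[v] | uw]; last first.
    by exists u; rewrite // mem_filter Ru uw mem_index_enum.
  by rewrite mem_filter => /andP[/andP[Rv vw] _] /(l_inj Ru Rv) ->.
apply: (boundX (pi := pi)).
- rewrite map_inj_in_uniq ?filter_uniq ?index_enum_uniq // => u v.
  by rewrite !mem_filter => /andP[/andP[Ru _] _] /andP[/andP[Rv _] _]; apply: l_inj.
- move=> _ /mapP[u uE ->]; exists u => //; apply: redE.
  by move: uE; rewrite mem_filter => /andP[/andP[]].
- by rewrite big_map big_filter.
exists w => [|u cu lu]; first by case: (c w) bw.
have Ru : R u by rewrite /R cu.
have /existsP[v /andP[uv vw]] : two_pathb c u w by rewrite -mem_pi.
by exists v.
Qed.

Lemma exists_group_of_coloring :
  exists (gT : finGroupType) (G : {group gT}) (P : X -> nat),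
    [/\ solvable G, power_free n #|G|, injective P,
        forall p, p \in primes #|G| <-> exists u, p = P u
      & forall u v, u != v ->
          ((exists i : Iirr G, P u * P v %| codegree i) <-> ~~ edge u v)].
Proof.
pose m := label_prod R l predT.
have m_gt0 : 0 < m by apply: label_prod_gt0.
have [g g_inj gP] := prime_family_1_mod X (\max_u l u) m_gt0.
have g_prime u : prime (g u) by have /and3P[] := gP u.
have gt_g u v : l u < g v.
  by have /and3P[_ lt _] := gP v; apply: leq_ltn_trans lt; apply: leq_bigmax.
pose m2 := (m * \prod_v g v)%N.
have m2_gt0 : 0 < m2 by rewrite muln_gt0 m_gt0 prodn_gt0 // => v; apply: prime_gt0.
have [b b_inj bP] := prime_family_1_mod X (\max_u g u) m2_gt0.
have b_prime u : prime (b u) by have /and3P[] := bP u.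
have gt_b u v : g u < b v.
  by have /and3P[_ lt _] := bP v; apply: leq_ltn_trans lt; apply: leq_bigmax.
have m_g v : m %| (g v).-1 by have /and3P[] := gP v.
have m2_b w : m2 %| (b w).-1 by have /and3P[] := bP w.
have m_b w : m %| (b w).-1 by apply: dvdn_trans (m2_b w); apply: dvdn_mulr.
have g_b v w : g v %| (b w).-1.
  by apply: dvdn_trans (m2_b w); rewrite dvdn_mull // (bigD1 v) //= dvdn_mulr.
have l_g u v : R u -> l u != g v by rewrite ltn_eqF.
have l_b u v : R u -> l u != b v by move=> _; rewrite ltn_eqF // (ltn_trans (gt_g u u)).
have g_neq_b u v : g u != b v by rewrite ltn_eqF.
exact: (exists_graph_group l_prime l_inj g_prime b_prime m_g m_b g_b g_inj b_inj
  l_g l_b g_neq_b tfX properX n_gt1 blue_dim_lt).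
Qed.
End Backward.

Theorem proposition3p7 (n : nat) (F : sgraph) (hn : 1 < n) :
  (exists (gT : finGroupType) (G : {group gT}),
     [/\ solvable G, power_free n #|G| & graph_iso F (cod_graph G)])
  <->
  (triangle_free (complement F) /\
   exists (c : complement F -> color) (l : complement F -> nat),
     [/\ proper_coloring c, red_labeling c l & bounded_two_paths c n l]).
Proof.
split=> [[gT [G [solG freeG [f bij_f edge_f]]]] | [tfX [c [l [pc rl bt]]]]].
  split; first exact: (@cod_graph_triangle_free _ _ _ solG _ bij_f edge_f).
  exact (cod_graph_coloring solG freeG bij_f edge_f).
have [gT [G [P [solG freeG P_inj primesG edgeP]]]] :=
  exists_group_of_coloring hn tfX pc rl bt.
exists gT, G; split=> //; apply: (@cod_graph_iso_of_primes F _ G P solG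
  P_inj primesG) => u v neq_uv.
by have := edgeP u v neq_uv; rewrite /= /compl_edge neq_uv negbK.
Qed.
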